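(* Let $x^0\in\mathcal{X}$ with $d_\Omega(x^0)\le 2\varepsilon$. Let $\gamma>2$ and let $\varepsilon,r>0$ satisfy $\frac{\varepsilon}{r}\le\frac{1}{3\sqrt d}$ and $r^2\le R\varepsilon$. Let $r$ and $n$ satisfy $$\left(\frac{3\gamma\,\rho_{\max}\,d^2\,\omega_d\,R^2}{C_x^2\,\rho_{\min}^2}\,\frac{\log n}{n}\right)^{\frac{1}{d+2}}\le r\le \frac{R\,C_y}{2C_x}.$$ Then $$\mathbb{P}\left(|\hat\nu_r(x^0)-\nu(x^0)|\ge \frac{13\,C_x}{R\,C_y}\,r\right)\le 2d\,n^{-\gamma}.$$
   Context: Setting: $\Omega\subset\mathbb{R}^d$ is a bounded domain such that both $\Omega$ and $\mathbb{R}^d\setminus\Omega$ have reach at least $R>0$ (the reach of a set $A$ is the maximal distance such that every point $x$ whose distance to $A$ is at most this value has a unique nearest point in $\overline A$). $\rho:\mathbb{R}^d\to[0,\infty)$ is a probability density with $0<\rho_{\min}\le\rho\le\rho_{\max}<\infty$ on $\Omega$, $\rho=0$ outside $\Omega$, and $\rho$ is Lipschitz on $\Omega$ with constant $L$. $\mathcal{X}=\{x^1,\dots,x^n\}$ is an i.i.d. sample with density $\rho$; in probability statements $x^0$ is treated as a fixed reference point. $B(x,r)$ is the ball of radius $r$ centered at $x$, $\omega_d$ is the volume of the unit ball in $\mathbb{R}^d$, and $d_\Omega(x)=\mathrm{dist}(x,\partial\Omega)$ for $x\in\Omega$. For $x\in\partial\Omega$, $\nu(x)$ is the inward unit normal;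 for $x\in\Omega$ with $d_\Omega(x)\le R$, $\nu(x)=\nu(x^* )$ where $x^*\in\partial\Omega$ is the closest point to $x$. First-order normal estimator: $\hat v_r(x^0)=\frac1n\sum_{i=1}^n \mathbf 1_{B(x^0,r)}(x^i)(x^i-x^0)$ and $\hat\nu_r(x^0)=\hat v_r(x^0)/|\hat v_r(x^0)|$ (with $\hat\nu_r(x^0)=0$ if $\hat v_r(x^0)=0$). Constants: $C_x=2\omega_{d-1}+\frac{LR\omega_d}{\rho_{\min}}$, $C_y=\frac{\omega_{d-1}}{2(d+1)}$. *)

(* Defs.v *)
From HB Require Import structures.
From mathcomp Require Import all_boot all_order all_algebra.
From mathcomp Require Import all_classical all_reals all_analysis.

Set Implicit Arguments.
Unset Strict Implicit.
Unset Printing Implicit Defensive.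
Import Order.TTheory GRing.Theory Num.Theory.
Import numFieldNormedType.Exports.
Local Open Scope classical_set_scope.
Local Open Scope ring_scope.

(* MathComp-Analysis. Points of R^d are row vectors 'rV[R]_d: the library's
   topology on them is the usual one, but its norm `|x| is the sup norm, so the
   Euclidean norm [enorm] is defined here. *)
Section euclidean.
Context {R : realType} {d : nat}.
Implicit Types (x y p v : 'rV[R]_d) (A Omega : set 'rV[R]_d).

Definition dotv x y : R := \sum_(i < d) x ord0 i * y ord0 i.

Definition enorm x : R := Num.sqrt (dotv x x).

Definition eball x (r : R) : set 'rV[R]_d := [set y | enorm (y - x) < r].

Definition dist_to x A : R := inf [set enorm (x - y) | y in A].

Definition frontier A : set 'rV[R]_d := closure A `\` A°.

Definition nearest A x p : Prop := A p /\ enorm (x - p) = dist_to x A.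

(* A supremum: the extremal distance itself need not be attained (for the
   complement of a ball it is the radius, and the centre is a bad point). *)
Definition reach A : \bar R :=
  ereal_sup [set t%:E | t in [set t : R | 0 <= t /\
    forall x, dist_to x A <= t -> exists! p, nearest (closure A) x p]].

Definition bounded_domain Omega : Prop :=
  [/\ Omega !=set0, open Omega, connected Omega & bounded_set Omega].

(* The unit vector v is the inward normal of Omega at the boundary point x when
   {y | 0 < (y - x).v} is the blow-up of Omega at x: near x, every cone
   {y | delta |y - x| < (y - x).v} lies in Omega and the opposite cone lies
   outside. For a domain with a differentiable boundary this is the usual inward
   normal, and there is at most one such v. *)
Definition inward_unit_normal Omega x v : Prop :=
  enorm v = 1 /\
  forall delta : R, 0 < delta -> \forall y \near x,
    (delta * enorm (y - x) < dotv (y - x) v -> Omega y) /\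
    (dotv (y - x) v < - (delta * enorm (y - x)) -> ~ Omega y).

Definition normal_at Omega x v : Prop :=
  exists2 xs, nearest (frontier Omega) x xs & inward_unit_normal Omega xs v.

End euclidean.

(* The sigma-algebra generated by the coordinates, as for the library's tuples. *)
Section measurable_rV.
Context {R : realType} (n : nat).

Let coord (i : 'I_n) (v : 'rV[R]_n) : R := v ord0 i.

Let rV_set0 : g_sigma_preimage coord set0.
Proof. exact: sigma_algebra0. Qed.

Let rV_setC A : g_sigma_preimage coord A -> g_sigma_preimage coord (~` A).
Proof. exact: sigma_algebraC. Qed.

Let rV_bigcup (F : (set 'rV[R]_n)^nat) :
  (forall i, g_sigma_preimage coord (F i)) ->
  g_sigma_preimage coord (\bigcup_i (F i)).
Proof. exact: sigma_algebra_bigcup. Qed.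

HB.instance Definition _ := @isMeasurable.Build default_measure_display
  'rV[R]_n (g_sigma_preimage coord) rV_set0 rV_setC rV_bigcup.

Lemma measurable_rV_coord (i : 'I_n) :
  measurable_fun [set: 'rV[R]_n] (fun v => v ord0 i : R).
Proof.
move=> _ Y mY; rewrite setTI; apply: sub_sigma_algebra => /=.
rewrite -bigcup_seq/=; exists i => /=; first by rewrite mem_index_enum.
by exists Y => //; rewrite setTI.
Qed.

Lemma measurable_fun_rVP d (T : measurableType d) (f : T -> 'rV[R]_n) :
  (forall i, measurable_fun [set: T] (fun t => f t ord0 i : R)) ->
  measurable_fun [set: T] f.
Proof.
move=> mf.
have H : g_sigma_preimage (fun i => coord i \o f) `<=` measurable.
  apply: smallest_sub; first exact: sigma_algebra_measurable.
  rewrite -bigcup_seq; apply: bigcup_sub => i _.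
  by move=> A [B mB <-]; exact: mf.
by move: H; rewrite g_sigma_preimage_comp => H _ A mA; apply: H; exists A.
Qed.

End measurable_rV.

Section cons_measure.
Context {R : realType} (n : nat).

Definition rV_cons (xv : R * 'rV[R]_n) : 'rV[R]_n.+1 :=
  \row_i oapp (xv.2 ord0) xv.1 (unlift ord0 i).

Definition rV_behead (v : 'rV[R]_n.+1) : 'rV[R]_n := \row_i v ord0 (lift ord0 i).

Lemma measurable_rV_cons : measurable_fun setT rV_cons.
Proof.
apply: measurable_fun_rVP => i.
case: (unliftP ord0 i) => [j ->|->].
- rewrite (_ : (fun _ => _) = (fun v : 'rV[R]_n => v ord0 j : R) \o snd).
    by apply: measurableT_comp; [exact: measurable_rV_coord|].
  by apply/funext => xv; rewrite /rV_cons mxE liftK.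
- rewrite (_ : (fun _ => _) = fst) //.
  by apply/funext => xv; rewrite /rV_cons mxE unlift_none.
Qed.

Lemma measurable_rV_behead : measurable_fun setT rV_behead.
Proof.
apply: measurable_fun_rVP => i.
rewrite (_ : (fun _ => _) = fun v : 'rV[R]_n.+1 => v ord0 (lift ord0 i) : R).
  exact: measurable_rV_coord.
by apply/funext => v; rewrite mxE.
Qed.

Variable mu : {sigma_finite_measure set 'rV[R]_n -> \bar R}.

Definition cons_measure : set 'rV[R]_n.+1 -> \bar R :=
  pushforward (@lebesgue_measure R \x mu)%E rV_cons.

Let cons_measure0 : cons_measure set0 = 0%E.
Proof. by rewrite /cons_measure /pushforward preimage_set0 measure0. Qed.

Let cons_measure_ge0 A : (0 <= cons_measure A)%E.
Proof. by rewrite /cons_measure /pushforward; exact: measure_ge0. Qed.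

Let cons_measure_sigma_additive : semi_sigma_additive cons_measure.
Proof.
move=> F mF tF mUF; rewrite /cons_measure /pushforward preimage_bigcup.
apply: measure_semi_sigma_additive.
- by move=> k; rewrite -[X in measurable X]setTI; apply: measurable_rV_cons.
- apply/trivIsetP => i j _ _ ij.
  by move/trivIsetP : tF => /(_ i j I I ij) FI; rewrite -preimage_setI FI preimage_set0.
- rewrite -preimage_bigcup -[X in measurable X]setTI.
  exact: measurable_rV_cons.
Qed.

HB.instance Definition _ := isMeasure.Build _ _ _ cons_measure
  cons_measure0 cons_measure_ge0 cons_measure_sigma_additive.

Let cons_measure_sigma_finite : sigma_finite setT cons_measure.
Proof.
have /sigma_finiteP[F [UF ndF mF]] := sigma_finiteT (@lebesgue_measure R).
have /sigma_finiteP[G [UG ndG mG]] := sigma_finiteT mu.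
exists (fun k => (fun v : 'rV[R]_n.+1 => v ord0 ord0 : R) @^-1` F k `&`
                 rV_behead @^-1` G k).
  apply/esym; rewrite -subTset => v _.
  have [i _ Fi] : (\bigcup_k F k) (v ord0 ord0) by rewrite -UF.
  have [j _ Gj] : (\bigcup_k G k) (rV_behead v) by rewrite -UG.
  exists (maxn i j) => //; split => /=.
  - by move: Fi; apply/subsetPset/ndF; rewrite leq_maxl.
  - by move: Gj; apply/subsetPset/ndG; rewrite leq_maxr.
move=> k; have [mFk Fk] := mF k; have [mGk Gk] := mG k; split.
  apply: measurableI; rewrite -[X in measurable X]setTI.
  - exact: measurable_rV_coord.
  - exact: measurable_rV_behead.
rewrite /cons_measure /pushforward (_ : _ @^-1` _ = F k `*` G k); last first.
  apply/seteqP; split=> -[x v] /=;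
    rewrite (_ : rV_behead (rV_cons (x, v)) = v) ?mxE ?unlift_none//;
    by apply/rowP => i; rewrite !mxE liftK.
by rewrite product_measure1E// lte_mul_pinfty// ge0_fin_numE.
Qed.

HB.instance Definition _ := Measure_isSigmaFinite.Build _ _ _ cons_measure
  cons_measure_sigma_finite.

End cons_measure.

(* d-dimensional Lebesgue measure: the product of d copies of Lebesgue measure
   on R, identifying R^(n+1) with R * R^n through [rV_cons]; a unit mass on the
   one-point space R^0. *)
Fixpoint lebesgue_rV {R : realType} (d : nat) :
    {sigma_finite_measure set 'rV[R]_d -> \bar R} :=
  match d with
  | 0 => dirac (0 : 'rV[R]_0)
  | d'.+1 => cons_measure (lebesgue_rV d')
  end.

Definition omega_ball (R : realType) (d : nat) : R :=
  fine (lebesgue_rV d (eball (0 : 'rV[R]_d) 1)).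

Section sampling.
Context {R : realType} {d : nat}.

Definition probability_density (rho : 'rV[R]_d -> R) : Prop :=
  [/\ measurable_fun setT rho, (forall x, 0 <= rho x) &
      (\int[lebesgue_rV d]_x (rho x)%:E = 1)%E].

Definition iid_sample dT (T : measurableType dT) (P : probability T R) (n : nat)
    (rho : 'rV[R]_d -> R) (X : 'I_n -> {RV P >-> 'rV[R]_d}) : Prop :=
  (forall i (A : set 'rV[R]_d), measurable A ->
     distribution P (X i) A = (\int[lebesgue_rV d]_(x in A) (rho x)%:E)%E) /\
  (forall (J : {set 'I_n}) (A : 'I_n -> set 'rV[R]_d),
     (forall i, measurable (A i)) ->
     P (\bigcap_(i in [set` J]) (X i @^-1` A i)) =
       (\prod_(i in J) P (X i @^-1` A i))%E).

Definition vhat (n : nat) (r : R) (x0 : 'rV[R]_d) (x : 'I_n -> 'rV[R]_d) :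
    'rV[R]_d :=
  n%:R^-1 *: \sum_(i < n) (\1_(eball x0 r) (x i) : R) *: (x i - x0).

(* When [vhat] vanishes this is 0, since 0^-1 = 0. *)
Definition nuhat (n : nat) (r : R) (x0 : 'rV[R]_d) (x : 'I_n -> 'rV[R]_d) :
    'rV[R]_d :=
  (enorm (vhat r x0 x))^-1 *: vhat r x0 x.

End sampling.

(* [rad] is the lower bound on the reach, L the Lipschitz constant. *)
Definition Cx {R : realType} (d : nat) (L rad rho_min : R) : R :=
  2 * omega_ball R d.-1 + L * rad * omega_ball R d / rho_min.

Definition Cy (R : realType) (d : nat) : R :=
  omega_ball R d.-1 / (2 * d.+1%:R).

(* Main.v *)
Require Import Defs.
From HB Require Import structures.
From mathcomp Require Import all_boot all_order all_algebra.
From mathcomp Require Import all_classical all_reals all_analysis.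
From mathcomp Require Import measurable_realfun ring lra.

Set Implicit Arguments.
Unset Strict Implicit.
Unset Printing Implicit Defensive.
Import Order.TTheory GRing.Theory Num.Theory.
Import numFieldNormedType.Exports.
Local Open Scope classical_set_scope.
Local Open Scope ring_scope.

(** The vector [vhat] is an empirical mean. Two facts make its direction close to the
    normal: its expectation is almost a positive multiple of the normal, and it
    deviates little from its expectation.

    For the expectation, suppose first that [Omega] is the half space bounded by the
    tangent plane at the boundary point nearest to [x0], at distance [delta] from
    [x0], and that the density is constant. The expectation is then, by symmetry, a
    multiple of the normal [nu]; its length is the density times the moment of a ball
    cut by a hyperplane, which is [2 * Cy] times
    [Num.sqrt (r ^+ 2 - delta ^+ 2) ^+ d.+1]. As [delta] is at most of order [r]
    divided by the square root of [d], this is of order [Cy * r ^+ d.+1]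
    ([sqrt_pow_ge]). In general the density differs from the constant [rho x0] by at
    most [L * r], and [Omega] differs from the half space, within the ball, only in a
    slab of width [2 * r ^+ 2 / rad] ([domain_between_slabs]); both errors together
    are at most [rho x0 * Cx * r ^+ d.+2 / rad] ([mean_bias], [mean_estimate]).

    The slab comes from the two balls tangent to the frontier, one inside and one
    outside [Omega]. Their existence is Federer's theorem on sets of positive reach:
    while nearest points are unique, the ray from a point of the set along a normal
    can be continued ([nearest_ray]). Instead of following the gradient flow of the
    distance, the proof maximises the distance on a ball about a point [p] of the
    ray; at a maximiser [q] the gradient is normal to the sphere, so that [p] lies
    between [q] and its nearest point ([nearest_ray_step]).

    The moments over balls are computed in coordinates adapted to the normal. This
    needs the invariance of Lebesgue measure under reflections, which follows from
    the proportionality of translation invariant measures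
    ([translation_invariant_proportional]): the image measure is translation
    invariant and gives the unit ball the same mass.

    For the deviation, the coordinates of the summands are bounded by [r] and have
    second moment at most [rho_max * omega_ball R d * r ^+ d.+2]. An exponential
    moment bound ([sum_tail_bound]) and a union bound over the [2 * d] one-sided
    deviations ([vhat_concentration]) give a deviation comparable with the bias,
    outside an event of probability [2 * d * n ^ (- gamma)]; the lower bound on [r]
    is what the exponent requires ([concentration_rate]). Normalizing at most doubles
    the relative error ([normalize_error]). *)

(** * Euclidean norm and topology *)

Section euclidean_algebra.
Context {R : realType} {d : nat}.
Implicit Types (x y z u v : 'rV[R]_d) (a : R).

Lemma dotvC x y : dotv x y = dotv y x.
Proof. by apply: eq_bigr => i _; rewrite mulrC. Qed.

Lemma dotvDl x y z : dotv (x + y) z = dotv x z + dotv y z.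
Proof. by rewrite -big_split; apply: eq_bigr => i _; rewrite mxE mulrDl. Qed.

Lemma dotvZl a x y : dotv (a *: x) y = a * dotv x y.
Proof. by rewrite mulr_sumr; apply: eq_bigr => i _; rewrite mxE mulrA. Qed.

Lemma dotvNl x y : dotv (- x) y = - dotv x y.
Proof. by rewrite -scaleN1r dotvZl mulN1r. Qed.

Lemma dotvDr x y z : dotv z (x + y) = dotv z x + dotv z y.
Proof. by rewrite !(dotvC z) dotvDl. Qed.

Lemma dotvZr a x y : dotv y (a *: x) = a * dotv y x.
Proof. by rewrite !(dotvC y) dotvZl. Qed.

Lemma dotvNr x y : dotv y (- x) = - dotv y x.
Proof. by rewrite !(dotvC y) dotvNl. Qed.

Lemma dot0v x : dotv 0 x = 0.
Proof. by rewrite /dotv big1// => i _; rewrite mxE mul0r. Qed.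

Definition dotvE := (dotvDl, dotvDr, dotvZl, dotvZr, dotvNl, dotvNr).

Lemma dotvv_ge0 x : 0 <= dotv x x.
Proof. by apply: sumr_ge0 => i _; exact: sqr_ge0. Qed.

Lemma enorm_ge0 x : 0 <= enorm x.
Proof. exact: sqrtr_ge0. Qed.

Lemma sqr_enorm x : enorm x ^+ 2 = dotv x x.
Proof. exact/sqr_sqrtr/dotvv_ge0. Qed.

Lemma enorm0 : enorm (0 : 'rV[R]_d) = 0.
Proof. by rewrite /enorm dot0v sqrtr0. Qed.

Lemma normr_coord_le_enorm x i : `|x ord0 i| <= enorm x.
Proof.
rewrite -sqrtr_sqr /enorm ler_sqrt ?dotvv_ge0// /dotv (bigD1 i)//=.
by rewrite expr2 lerDl sumr_ge0// => j _; exact: sqr_ge0.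
Qed.

Lemma enorm_eq0 x : enorm x = 0 -> x = 0.
Proof.
move=> x0; apply/rowP => i; rewrite mxE; apply/normr0_eq0/eqP.
by rewrite eq_le normr_ge0 andbT -x0 normr_coord_le_enorm.
Qed.

Lemma enormZ a x : enorm (a *: x) = `|a| * enorm x.
Proof.
by rewrite /enorm dotvZl dotvZr mulrA -expr2 sqrtrM ?sqr_ge0// sqrtr_sqr.
Qed.

Lemma enormN x : enorm (- x) = enorm x.
Proof. by rewrite -scaleN1r enormZ normrN1 mul1r. Qed.

Lemma enormB x y : enorm (x - y) = enorm (y - x).
Proof. by rewrite -enormN opprB. Qed.

(** The square of [enorm y *: x - enorm x *: y] is nonnegative. *)
Lemma dotv_le_enorm x y : dotv x y <= enorm x * enorm y.
Proof.
have [x0|x0] := eqVneq (enorm x) 0.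
  by rewrite (enorm_eq0 x0) dot0v enorm0 mul0r.
have [y0|y0] := eqVneq (enorm y) 0.
  by rewrite (enorm_eq0 y0) dotvC dot0v enorm0 mulr0.
have xy : 0 < enorm x * enorm y by rewrite mulr_gt0// lt0r enorm_ge0 andbT.
have := dotvv_ge0 (enorm y *: x - enorm x *: y).
rewrite !dotvE -!sqr_enorm (dotvC y x) => h.
rewrite -(ler_pM2l xy); nra.
Qed.

Lemma normr_dotv_le x y : `|dotv x y| <= enorm x * enorm y.
Proof.
by rewrite ler_norml dotv_le_enorm andbT lerNl -dotvNl -(enormN x) dotv_le_enorm.
Qed.

Lemma enormD x y : enorm (x + y) <= enorm x + enorm y.
Proof.
rewrite -ler_sqr ?nnegrE ?addr_ge0 ?enorm_ge0// sqr_enorm !dotvE -!sqr_enorm.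
by rewrite (dotvC y x); have := dotv_le_enorm x y; lra.
Qed.

Lemma enorm_triangle y x z : enorm (x - z) <= enorm (x - y) + enorm (y - z).
Proof. by rewrite -[x - z](subrKA y) enormD. Qed.

Lemma enorm_ball x a : 0 < a -> (enorm x < a) = (dotv x x < a ^+ 2).
Proof. by move=> a0; rewrite -sqr_enorm ltr_sqr ?nnegrE ?enorm_ge0 ?ltW. Qed.

(** The equality case of Cauchy-Schwarz, used to identify two unit vectors. *)
Lemma dotv_lt1 u v : enorm u = 1 -> enorm v <= 1 -> u != v -> dotv u v < 1.
Proof.
move=> u1 v1; apply: contraNT; rewrite -leNgt => uv; apply/eqP.
apply/subr0_eq/enorm_eq0/eqP; rewrite -sqrf_eq0 eq_le sqr_ge0 andbT.
rewrite sqr_enorm !dotvE -!sqr_enorm u1 (dotvC v u).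
have := enorm_ge0 v; nra.
Qed.

End euclidean_algebra.

Section euclidean_topology.
Context {R : realType} {d : nat}.
Implicit Types (x y : 'rV[R]_d) (A : set 'rV[R]_d).

Lemma enorm_le_coord x (t : R) :
  0 <= t -> (forall i, `|x ord0 i| <= t) -> enorm x <= d%:R * t.
Proof.
move=> t0 xt; rewrite -ler_sqr ?nnegrE ?enorm_ge0 ?mulr_ge0// sqr_enorm.
apply: (@le_trans _ _ (\sum_(i < d) t ^+ 2)).
  by apply: ler_sum => i _; rewrite -expr2 -real_normK ?num_real// lerXn2r ?nnegrE.
rewrite sumr_const card_ord -[leLHS]mulr_natl exprMn ler_wpM2r ?sqr_ge0//.
by rewrite -natrX ler_nat; case: (d) => // k; rewrite leq_pmulr.
Qed.

Lemma enorm_le_norm x : enorm x <= d%:R * `|x|.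
Proof.
apply: enorm_le_coord => // i.
rewrite [leRHS]/Num.norm/= mx_normrE; apply/bigmax_geP; right => /=.
by exists (ord0, i).
Qed.

Lemma norm_le_enorm x : `|x| <= enorm x.
Proof.
rewrite [leLHS]/Num.norm/= mx_normrE; apply/bigmax_leP; split => [|[i j] _ /=].
  exact: enorm_ge0.
by rewrite (ord1 i) normr_coord_le_enorm.
Qed.

(** The topology of row vectors comes from the sup norm, which is equivalent to the
    Euclidean norm. *)
Lemma nbhs_enormP x A :
  nbhs x A <-> exists2 e : R, 0 < e & forall y, enorm (y - x) < e -> A y.
Proof.
split=> [/nbhs_ballP[e /= e0 xeA]|[e e0 xeA]].
  exists e => // y yx; apply: xeA; rewrite -ball_normE /= distrC.
  exact: le_lt_trans (norm_le_enorm _) yx.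
apply/nbhs_ballP; exists (e / d.+1%:R) => /=; first by rewrite divr_gt0.
move=> y; rewrite -ball_normE /= distrC ltr_pdivlMr ?ltr0Sn// => xy; apply: xeA.
apply: le_lt_trans (enorm_le_norm _) _; apply: le_lt_trans xy.
by rewrite mulrC ler_wpM2l// ler_nat.
Qed.

Lemma closure_enormP x A :
  closure A x <-> forall e : R, 0 < e -> exists2 y, A y & enorm (y - x) < e.
Proof.
split=> [Ax e e0|H U /nbhs_enormP[e e0 xeU]].
  have /Ax[y [Ay yx]] : nbhs x [set y | enorm (y - x) < e].
    by apply/nbhs_enormP; exists e.
  by exists y.
by have [y Ay /xeU Uy] := H _ e0; exists y.
Qed.

Lemma lipschitz_enorm_continuous (f : 'rV[R]_d -> R) (k : R) :
  (forall x y, `|f x - f y| <= k * enorm (x - y)) -> continuous f.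
Proof.
move=> fk x; apply/(@cvgrPdist_lt _ _ _ (nbhs x)) => e e0; apply/nbhs_enormP.
have k0 : 0 < `|k| + 1 by rewrite ltr_wpDl.
exists (e / (`|k| + 1)); first by rewrite divr_gt0.
move=> y; rewrite ltr_pdivlMr// => yx; apply: le_lt_trans (fk _ _) _.
rewrite enormB; apply: le_lt_trans yx; rewrite mulrC ler_wpM2l ?enorm_ge0//.
by rewrite (le_trans (ler_norm k))// lerDl.
Qed.

Lemma enorm_sub_continuous x : continuous (fun y => enorm (y - x)).
Proof.
apply: (@lipschitz_enorm_continuous _ 1) => y z; rewrite mul1r ler_norml.
have := enorm_triangle z y x; have := enorm_triangle y z x.
by rewrite (enormB z y) => *; apply/andP; split; lra.
Qed.

Lemma closed_eball_compact x (e : R) : compact [set y | enorm (y - x) <= e].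
Proof.
apply: bounded_closed_compact.
  exists (`|x| + e); split; first exact: num_real.
  move=> M ltM y /= yx; rewrite -[y](subrK x) addrC.
  apply: le_trans (ler_normD _ _) _; apply: le_trans (ltW ltM).
  by rewrite lerD2l (le_trans (norm_le_enorm _)).
apply: (@preimage_closed _ _ (fun y => enorm (y - x)) [set t | t <= e]).
  by move=> y _; exact: enorm_sub_continuous.
exact: closed_le.
Qed.

End euclidean_topology.

(** * Distance to a set of positive reach *)

Section distance.
Context {R : realType} {d : nat}.
Implicit Types (x y p q : 'rV[R]_d) (A C : set 'rV[R]_d).

Lemma dist_to_le x y A : A y -> dist_to x A <= enorm (x - y).
Proof.
move=> Ay; apply: ge_inf; last by exists y.
by exists 0 => _ [z _ <-]; exact: enorm_ge0.
Qed.

Lemma le_dist_to x A (t : R) :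
  A !=set0 -> (forall y, A y -> t <= enorm (x - y)) -> t <= dist_to x A.
Proof.
move=> [y Ay] tA; apply: lb_le_inf; first by exists (enorm (x - y)); exists y.
by move=> _ [z Az <-]; exact: tA.
Qed.

Lemma dist_to_lip x y A :
  A !=set0 -> dist_to x A <= dist_to y A + enorm (x - y).
Proof.
move=> A0; rewrite -lerBlDr; apply: le_dist_to => // z Az.
by rewrite lerBlDr (le_trans (dist_to_le x Az))// [leRHS]addrC enorm_triangle.
Qed.

Lemma dist_to_continuous A : A !=set0 -> continuous (dist_to ^~ A).
Proof.
move=> A0; apply: (@lipschitz_enorm_continuous _ _ _ 1) => x y; rewrite mul1r.
have := dist_to_lip x y A0; have := dist_to_lip y x A0.
by rewrite (enormB y x) ler_norml => *; apply/andP; split; lra.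
Qed.

Lemma dist_to_closure x A :
  A !=set0 -> dist_to x (closure A) = dist_to x A.
Proof.
move=> A0; have [a Aa] := A0.
apply/eqP; rewrite eq_le; apply/andP; split.
  by apply: le_dist_to => // y Ay; apply/dist_to_le/subset_closure.
apply: le_dist_to; first by exists a; exact: subset_closure.
move=> y /closure_enormP clA; apply/ler_addgt0Pr => e /clA[z Az zy].
apply: le_trans (dist_to_le x Az) _; apply: le_trans (enorm_triangle y _ _) _.
by rewrite lerD2l enormB ltW.
Qed.

End distance.

Section positive_reach.
Context {R : realType} {d : nat}.
Variables (C : set 'rV[R]_d) (rad : R).
Hypotheses (closedC : closed C) (C0 : C !=set0).
Hypothesis unp : forall x, dist_to x C < rad -> exists! p, nearest C x p.
Implicit Types (x y p q b u v : 'rV[R]_d).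

Let nearest_uniq x p q :
  dist_to x C < rad -> nearest C x p -> nearest C x q -> p = q.
Proof. by move=> /unp[z [_ zP]] /zP<- /zP<-. Qed.

(** The part that is needed of the fact that the distance to [C] has gradient
    [(q - b) / dist_to q C]. If the distance did not increase for arbitrarily small
    steps [t *: u], the nearest points of the [q + t *: u] would all be points [a]
    with [dotv u (q - a) <= 0]; by compactness one such [a] would be a second nearest
    point of [q], as [b] does not satisfy this inequality. *)
Lemma dist_to_increase q b u (t0 : R) :
  dist_to q C < rad -> nearest C q b -> 0 < dotv u (q - b) -> 0 < t0 ->
  (forall t, 0 < t <= t0 -> dist_to (q + t *: u) C < rad) ->
  exists2 t, 0 < t <= t0 & dist_to q C < dist_to (q + t *: u) C.
Proof.
move=> qrad qb ub t00 trad; apply: contrapT => noincr.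
have le_dist t : 0 < t <= t0 -> dist_to (q + t *: u) C <= dist_to q C.
  by move=> tt0; rewrite leNgt; apply/negP => lt; apply: noincr; exists t.
pose K := [set a | [/\ C a, dotv u (q - a) <= 0 &
                      enorm (a - q) <= dist_to q C + t0 * enorm u]].
have Kt t : 0 < t <= t0 ->
    exists2 a, K a & enorm (a - q) <= dist_to q C + t * enorm u.
  move=> /[dup] tt0 /andP[t_gt0 t_le].
  have [a [[Ca qa] _]] := unp (trad _ tt0).
  have aq : enorm (a - q) <= dist_to q C + t * enorm u.
    rewrite enormB; apply: le_trans (enorm_triangle (q + t *: u) _ _) _.
    rewrite addrC qa lerD ?le_dist// opprD addNKr enormN enormZ.
    by rewrite gtr0_norm.
  exists a => //; split => //; last first.
    by rewrite (le_trans aq)// lerD2l ler_wpM2r ?enorm_ge0.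
  have h1 : enorm (q + t *: u - a) <= enorm (q - a).
    by rewrite qa; apply: le_trans (le_dist _ tt0) _; exact: dist_to_le.
  move: h1; rewrite -ler_sqr ?nnegrE ?enorm_ge0// !sqr_enorm.
  have -> : q + t *: u - a = t *: u + (q - a) by rewrite addrCA addrA.
  move: (q - a) => z; rewrite !dotvE (dotvC z u) => h2.
  by have uu := dotvv_ge0 u; rewrite -(ler_pM2l t_gt0) mulr0; nra.
have Kcpt : compact K.
  have -> : K = C `&` [set a | dotv u (q - a) <= 0] `&`
                [set a | enorm (a - q) <= dist_to q C + t0 * enorm u].
    by apply/seteqP; split => a /=; [move=> [? ? ?]|move=> [[? ?] ?]].
  rewrite setIC; apply: compact_closedI; first exact: closed_eball_compact.
  apply: closedI => //.
  apply: (@preimage_closed 'rV[R]_d R (fun a => dotv u (q - a)) [set t : R | t <= 0]).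
    move=> a _; apply: (@lipschitz_enorm_continuous _ _ _ (enorm u)) => x y.
    by rewrite -dotvNr -dotvDr opprB addrC subrKA (enormB x) normr_dotv_le.
  exact: closed_le.
have [a0 Ka0 _] := Kt t0 ltac:(by rewrite t00 lexx).
have [c /[1!inE] Kc cmin] : exists2 c, c \in K &
    forall a, a \in K -> enorm (c - q) <= enorm (a - q).
  apply: compact_EVT_min => //; first by exists a0.
  by apply: continuous_subspaceT => ?; exact: enorm_sub_continuous.
have [Cc uc _] := Kc.
have qc : nearest C q c.
  split=> //; apply/eqP; rewrite eq_le dist_to_le// andbT enormB.
  apply/ler_addgt0Pr => e e0.
  have u1 : 0 < enorm u + 1 by rewrite ltr_wpDl ?enorm_ge0.
  pose t := Num.min t0 (e / (enorm u + 1)).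
  have tt0 : 0 < t <= t0 by rewrite lt_min t00 divr_gt0//= ge_min lexx.
  have [a Ka aq] := Kt t tt0.
  apply: le_trans (cmin a (mem_set Ka)) _; apply: le_trans aq _.
  rewrite lerD2l; apply: (@le_trans _ _ (t * (enorm u + 1))).
    by rewrite ler_wpM2l ?lerDl//; case/andP: tt0 => /ltW.
  by rewrite -ler_pdivlMr// ge_min lexx orbT.
by move: ub; rewrite (nearest_uniq qrad qb qc) ltNge uc.
Qed.

(** The distance to [C] is maximal on the ball of radius [h] about [p] at the point
    that continues the ray from the nearest point [b] through [p]: at a maximiser
    [q] the gradient must be the outer unit normal of that ball. *)
Lemma nearest_ray_step p b (h : R) :
  nearest C p b -> 0 < h -> h <= dist_to p C -> dist_to p C + h < rad ->
  dist_to (p + (h / dist_to p C) *: (p - b)) C = dist_to p C + h.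
Proof.
move=> pb h0 hp hrad; have p0 := lt_le_trans h0 hp.
pose B := [set q | enorm (q - p) <= h].
have [q /[1!inE] Bq qmax] : exists2 q, q \in B &
    forall x, x \in B -> dist_to x C <= dist_to q C.
  apply: compact_EVT_max; last exact/continuous_subspaceT/dist_to_continuous.
    by exists p; rewrite /B/= subrr enorm0 ltW.
  exact: closed_eball_compact.
have Brad x : B x -> dist_to x C < rad.
  move=> Bx; apply: le_lt_trans hrad.
  by apply: le_trans (dist_to_lip x p C0) _; rewrite lerD2l.
have pq : dist_to p C <= dist_to q C.
  by apply: qmax; rewrite inE /B/= subrr enorm0 ltW.
have q0 := lt_le_trans p0 pq.
have [b' [qb' _]] := unp (Brad _ Bq).
pose g := (dist_to q C)^-1 *: (q - b').
pose w := h^-1 *: (q - p).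
have g1 : enorm g = 1.
  by rewrite enormZ qb'.2 gtr0_norm ?invr_gt0// mulVf ?gt_eqF.
have w1 : enorm w <= 1.
  by rewrite enormZ gtr0_norm ?invr_gt0// mulrC ler_pdivrMr// mul1r.
have gE : q - b' = dist_to q C *: g by rewrite scalerA divff ?gt_eqF// scale1r.
have wE : q - p = h *: w by rewrite scalerA divff ?gt_eqF// scale1r.
have gw : g = w.
  apply/eqP; apply: contrapT => /negP gw.
  have gw1 := dotv_lt1 g1 w1 gw.
  have uB t : 0 < t <= h -> B (q + t *: (g - w)).
    move=> /andP[t0 th]; rewrite /B/=.
    have -> : q + t *: (g - w) - p = (h - t) *: w + t *: g.
      rewrite addrAC wE scalerBl scalerBr -!addrA; congr (_ + _).
      by rewrite addrC.
    apply: le_trans (enormD _ _) _; rewrite (enormZ (h - t)) (enormZ t) g1 ger0_norm ?subr_ge0//.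
    rewrite gtr0_norm// mulr1; have : (h - t) * enorm w <= (h - t) * 1.
      by rewrite ler_wpM2l ?subr_ge0.
    lra.
  have ug : 0 < dotv (g - w) (q - b').
    rewrite gE dotvZr mulr_gt0// dotvDl dotvNl -sqr_enorm g1 (dotvC w) expr1n.
    by rewrite subr_gt0.
  have [t th] := dist_to_increase (Brad _ Bq) qb' ug h0
    (fun t th => Brad _ (uB t th)).
  by rewrite ltNge qmax// inE; exact: uB.
have pE : p - b' = (dist_to q C - h) *: g.
  by rewrite scalerBl -gE gw -wE; apply/rowP => i; rewrite !mxE; ring.
have pb'le := dist_to_le p qb'.1.
rewrite pE enormZ g1 mulr1 ger0_norm in pb'le; last by rewrite subr_ge0 (le_trans hp).
have qE : dist_to q C = dist_to p C + h.
  apply/eqP; rewrite eq_le; apply/andP; split; last by rewrite -lerBrDr.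
  by apply: le_trans (dist_to_lip q p C0) _; rewrite lerD2l.
have pb' : nearest C p b'.
  split; first exact: qb'.1.
  by rewrite pE enormZ g1 mulr1 qE addrK gtr0_norm.
have -> : b = b'.
  by apply: nearest_uniq pb pb'; rewrite (lt_trans _ hrad)// ltrDl.
rewrite pE qE addrK scalerA divfK ?gt_eqF// gw -wE addrC subrK.
exact: qE.
Qed.

(** Federer's theorem on sets of positive reach: a ray along which [b] is nearest at
    some point can be followed up to the reach. Each step of [nearest_ray_step]
    doubles the distance. *)
Lemma nearest_ray b v (s0 s : R) :
  C b -> enorm v = 1 -> 0 < s0 -> dist_to (b + s0 *: v) C = s0 ->
  0 < s < rad -> dist_to (b + s *: v) C = s.
Proof.
move=> Cb v1 s00 bs0 srad.
have le_s t : 0 < t -> dist_to (b + t *: v) C <= t.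
  move=> t0; apply: le_trans (dist_to_le _ Cb) _.
  by rewrite addrAC subrr add0r enormZ v1 mulr1 gtr0_norm.
suff H k t : 0 < t < rad -> t <= 2 ^+ k * s0 -> dist_to (b + t *: v) C = t.
  apply: (H (Num.trunc (s / s0)).+1) => //; rewrite -ler_pdivrMr//.
  apply: ltW; apply: lt_le_trans (truncnS_gt _) _.
  by rewrite -natrX ler_nat ltnW// ltn_expl.
elim: k t => [|k IH] t /andP[t0 trad] tk.
  apply/eqP; rewrite eq_le le_s//=; move: tk; rewrite expr0 mul1r => ts0.
  have := dist_to_lip (b + s0 *: v) (b + t *: v) C0.
  rewrite bs0 opprD addrACA subrr add0r -scalerBl enormZ v1 mulr1.
  by rewrite ger0_norm ?subr_ge0//; lra.
have t2 : dist_to (b + (t / 2) *: v) C = t / 2.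
  apply: IH; first by apply/andP; split; lra.
  by rewrite ler_pdivrMr// mulrC mulrA -exprS.
have pb : nearest C (b + (t / 2) *: v) b.
  by split=> //; rewrite addrAC subrr add0r enormZ v1 mulr1 gtr0_norm ?divr_gt0.
have pbE : b + (t / 2) *: v - b = (t / 2) *: v by rewrite addrAC subrr add0r.
have := @nearest_ray_step _ _ (t / 2) pb.
rewrite t2 pbE divff ?gt_eqF ?divr_gt0// scale1r -splitr.
have -> : b + (t / 2) *: v + (t / 2) *: v = b + t *: v.
  by rewrite -addrA -scalerDl -splitr.
by apply; rewrite ?divr_gt0.
Qed.

(** A ball of radius less than the reach that touches [C] at [a] along an outer
    normal [v] does not meet [C]. The normal [v] is only a first order condition,
    but the nearest points [b] of [a + t *: v] satisfy [b = a + o(t)]; the rays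
    from [b] through [a + t *: v] thus tend to the ray from [a] along [v]. *)
Lemma outer_tangent_ball a v (s : R) : C a -> enorm v = 1 ->
  (forall eta, 0 < eta -> exists2 e, 0 < e & forall y, C y -> enorm (y - a) < e ->
     dotv (y - a) v <= eta * enorm (y - a)) ->
  0 < s < rad -> forall y, C y -> s <= enorm (a + s *: v - y).
Proof.
move=> Ca v1 cone srad y Cy; have /andP[s0 s_rad] := srad.
rewrite leNgt; apply/negP => ys.
pose D := s - enorm (a + s *: v - y).
have D0 : 0 < D by rewrite subr_gt0.
(* The final error is at most [2 * eta + 8 * s * eta], which is less than [D]. *)
pose eta := Num.min (4^-1) (D / (4 * (1 + 4 * s))).
have eta0 : 0 < eta.
  rewrite lt_min invr_gt0 ltr0n/= divr_gt0// mulr_gt0// addr_gt0// mulr_gt0//.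
have eta4 : eta <= 4^-1 by rewrite ge_min lexx.
have etaD : (1 + 4 * s) * eta <= D / 4.
  have : eta <= D / (4 * (1 + 4 * s)) by rewrite ge_min lexx orbT.
  by rewrite ler_pdivlMr ?ler_pdivlMr// ?mulr_gt0 ?addr_gt0 ?mulr_gt0//; lra.
have [e e0 eC] := cone eta eta0.
pose t := Num.min (Num.min 1 (e / 4)) (s / 2).
have t0 : 0 < t by rewrite !lt_min ltr01 !divr_gt0.
have t1 : t <= 1 by rewrite !ge_min lexx.
have te : t <= e / 4 by rewrite !ge_min lexx orbT.
have ts : t <= s / 2 by rewrite ge_min lexx orbT.
have pt : dist_to (a + t *: v) C <= t.
  apply: le_trans (dist_to_le _ Ca) _.
  by rewrite addrAC subrr add0r enormZ v1 mulr1 gtr0_norm.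
have [b [[Cb pb] _]] := unp (x := a + t *: v) ltac:(lra).
pose w := b - a.
have pbE : a + t *: v - b = t *: v - w.
  by apply/rowP => i; rewrite !mxE; ring.
have wt : enorm (t *: v - w) <= t by rewrite -pbE pb.
have w2 : dotv w w <= 2 * t * dotv w v.
  move: wt; move: (w) => z.
  rewrite -ler_sqr ?nnegrE ?enorm_ge0 ?(ltW t0)// sqr_enorm.
  by rewrite !dotvE -(sqr_enorm v) v1 (dotvC v z); lra.
have wle : enorm w <= 2 * t.
  have := dotv_le_enorm w v; rewrite v1 mulr1 -(ler_pM2l t0).
  by have := enorm_ge0 w; move: w2; rewrite -sqr_enorm; nra.
have weta : enorm w <= 2 * t * eta.
  have [->|w0] := eqVneq (enorm w) 0; first by rewrite !mulr_ge0// ltW.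
  have wpos : 0 < enorm w by rewrite lt0r w0 enorm_ge0.
  have := eC b Cb; rewrite -/w => /(_ ltac:(lra)); rewrite -(ler_pM2l t0) => h.
  by rewrite -(ler_pM2r wpos); move: w2; rewrite -sqr_enorm; lra.
pose D' := dist_to (a + t *: v) C.
have D't : t - enorm w <= D'.
  rewrite /D' -pb pbE; have := enorm_triangle (t *: v) 0 w.
  have := enormD (t *: v - w) w.
  by rewrite subrK enormZ v1 mulr1 gtr0_norm//; lra.
have wt2 : enorm w <= t / 2 by nra.
have D'0 : 0 < D' by lra.
pose g := D'^-1 *: (a + t *: v - b).
have g1 : enorm g = 1.
  by rewrite enormZ pb gtr0_norm ?invr_gt0// mulVf ?gt_eqF.
have gE : b + D' *: g = a + t *: v.
  by rewrite scalerA divff ?gt_eqF// scale1r addrC subrK.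
have := @nearest_ray b g D' s Cb g1 D'0; rewrite gE => /(_ erefl srad) bs.
have := dist_to_le (b + s *: g) Cy; rewrite bs => sy.
have gv : D' * enorm (g - v) <= 2 * enorm w.
  rewrite -[X in X * _]gtr0_norm// -enormZ scalerBr scalerA divff ?gt_eqF//.
  rewrite scale1r pbE.
  have -> : t *: v - w - D' *: v = (t - D') *: v - w by rewrite scalerBl addrAC.
  apply: le_trans (enormD _ _) _; rewrite enormN enormZ v1 mulr1.
  by rewrite ger0_norm ?subr_ge0//; lra.
have gv4 : enorm (g - v) <= 8 * eta.
  by have := enorm_ge0 (g - v); nra.
have : enorm (b + s *: g - y) <= enorm (a + s *: v - y) + (enorm w + s * enorm (g - v)).
  have -> : b + s *: g - y = (a + s *: v - y) + (w + s *: (g - v)).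
    rewrite /w scalerBr; apply/rowP => i; rewrite !mxE; ring.
  apply: le_trans (enormD _ _) _; rewrite lerD2l.
  by apply: le_trans (enormD _ _) _; rewrite enormZ gtr0_norm.
rewrite -/D in D0 *; move: sy; rewrite /D in etaD D0 *.
nra.
Qed.

End positive_reach.

(** * Tangent balls of a domain *)

Section tangent_balls.
Context {R : realType} {d : nat}.
Implicit Types (x y a v nu : 'rV[R]_d) (A Omega : set 'rV[R]_d) (rad s : R).

Lemma reach_nearest A rad : A !=set0 -> (rad%:E <= reach A)%E ->
  forall x, dist_to x (closure A) < rad -> exists! p, nearest (closure A) x p.
Proof.
move=> A0 hA x xrad.
have : ((dist_to x A)%:E < reach A)%E.
  by apply: lt_le_trans hA; rewrite lte_fin -dist_to_closure.
by move=> /ereal_sup_gt[_ [t [_ tA] <-]]; rewrite lte_fin => /ltW /tA.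
Qed.

(** The first order condition extends to [closure A], where the nearest points are. *)
Lemma reach_tangent_ball A a v rad s :
  (rad%:E <= reach A)%E -> closure A a -> enorm v = 1 ->
  (forall eta, 0 < eta ->
     \forall y \near a, A y -> dotv (y - a) v <= eta * enorm (y - a)) ->
  0 < s < rad -> forall y, A y -> s <= enorm (a + s *: v - y).
Proof.
move=> hA Aa v1 cone srad y Ay; have A0 : A !=set0 by exists y.
apply: (@outer_tangent_ball _ _ (closure A) rad) => //.
- exact: closed_closure.
- by exists y; exact: subset_closure.
- exact: reach_nearest.
- move=> eta eta0; have /nbhs_enormP[e e0 eA] := cone _ eta0.
  exists e => // z Az ze; apply/ler_addgt0Pr => k k0.
  pose k' := Num.min (k / (1 + eta)) (e - enorm (z - a)).
  have e1 : 0 < 1 + eta by rewrite addr_gt0.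
  have k'0 : 0 < k' by rewrite lt_min divr_gt0//= subr_gt0.
  have [z' Az' zz'] := (closure_enormP _ _).1 Az _ k'0.
  have h1 : k' * (1 + eta) <= k by rewrite -ler_pdivlMr// ge_min lexx.
  have h2 : k' <= e - enorm (z - a) by rewrite ge_min lexx orbT.
  have tri := enorm_triangle z z' a.
  have := eA z' ltac:(lra) Az'.
  have -> : dotv (z' - a) v = dotv (z - a) v + dotv (z' - z) v.
    by rewrite -dotvDl [_ + (z' - z)]addrC subrKA.
  have := normr_dotv_le (z' - z) v; rewrite v1 mulr1 ler_norml => /andP[+ _].
  have := ler_wpM2l (ltW eta0) tri; nra.
- exact: subset_closure.
Qed.

Lemma open_frontierE Omega : open Omega -> frontier Omega = closure Omega `\` Omega.
Proof. by move=> /interior_id oO; rewrite /frontier oO. Qed.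

(** A point [z] outside [Omega] that is nearest to [x] is on the frontier, because
    the points of the segment from [z] to [x] are closer to [x], hence in [Omega]. *)
Lemma dist_to_frontier_le Omega x y : open Omega -> Omega x -> ~ Omega y ->
  dist_to x (frontier Omega) <= enorm (x - y).
Proof.
move=> oO Ox Oy.
pose K := ~` Omega `&` [set z | enorm (z - x) <= enorm (y - x)].
have cK : compact K.
  rewrite /K setIC; apply: compact_closedI; first exact: closed_eball_compact.
  exact: open_closedC.
have [z /[1!inE] Kz zmin] : exists2 z, z \in K &
    forall w, w \in K -> enorm (z - x) <= enorm (w - x).
  apply: compact_EVT_min => //; first by exists y; split => /=.
  by apply: continuous_subspaceT => ?; exact: enorm_sub_continuous.
have [Oz zy] := Kz.
apply: (@le_trans _ _ (enorm (x - z))); last by rewrite enormB (enormB x).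
apply: dist_to_le; rewrite open_frontierE//; split => //.
apply/closure_enormP => e e0.
have zx : 0 < enorm (z - x).
  rewrite lt0r enorm_ge0 andbT; apply/eqP => /enorm_eq0/subr0_eq zx.
  by apply: Oz; rewrite zx.
pose t := Num.min 1 (e / (2 * enorm (z - x))).
have t0 : 0 < t by rewrite lt_min ltr01 divr_gt0// mulr_gt0.
have t1 : t <= 1 by rewrite ge_min lexx.
have te : t * enorm (z - x) < e.
  have : t <= e / (2 * enorm (z - x)) by rewrite ge_min lexx orbT.
  by rewrite ler_pdivlMr ?mulr_gt0//; lra.
exists (z + t *: (x - z)); last first.
  by rewrite addrAC subrr add0r enormZ gtr0_norm// enormB.
apply: contrapT => Ow.
have wx : enorm (z + t *: (x - z) - x) = (1 - t) * enorm (z - x).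
  have -> : z + t *: (x - z) - x = (1 - t) *: (z - x).
    by apply/rowP => i; rewrite !mxE; ring.
  by rewrite enormZ ger0_norm// subr_ge0.
have /zmin : z + t *: (x - z) \in K.
  by rewrite inE; split => //=; rewrite wx; apply: le_trans zy; nra.
by rewrite wx; nra.
Qed.

(** The ball about [x] through [xs] is contained in [Omega], so that its inner normal
    at [xs] is also the one of [Omega]. *)
Lemma frontier_nearest_normal Omega x xs nu :
  open Omega -> Omega x -> nearest (frontier Omega) x xs ->
  inward_unit_normal Omega xs nu ->
  0 < dist_to x (frontier Omega) /\
  x - xs = dist_to x (frontier Omega) *: nu.
Proof.
move=> oO Ox [Fxs xxs] [nu1 cone]; set D := dist_to _ _ in xxs *.
have Oxs : ~ Omega xs by move: Fxs; rewrite open_frontierE// => -[].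
have D0 : 0 < D.
  rewrite -xxs lt0r enorm_ge0 andbT; apply/eqP => /enorm_eq0/subr0_eq E.
  by apply: Oxs; rewrite -E.
split => //; pose g := D^-1 *: (x - xs).
have g1 : enorm g = 1 by rewrite enormZ xxs gtr0_norm ?invr_gt0// mulVf ?gt_eqF.
have gE : x - xs = D *: g by rewrite scalerA divff ?gt_eqF// scale1r.
rewrite gE; congr (_ *: _); apply/eqP; apply: contrapT => /negP gnu.
(* Along [u], the first order condition leaves [Omega] whereas the ball about [x]
   stays in it. *)
pose u := g - nu.
have gnu1 : dotv g nu < 1 by apply: dotv_lt1 => //; rewrite nu1.
have ug : 0 < dotv u g.
  by rewrite dotvDl dotvNl -sqr_enorm g1 expr1n (dotvC nu) subr_gt0.
have unu : dotv u nu < 0.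
  by rewrite dotvDl dotvNl -sqr_enorm nu1 expr1n subr_lt0.
have u0 : 0 < enorm u.
  rewrite lt0r enorm_ge0 andbT; apply/eqP => /enorm_eq0 u0.
  by move: ug; rewrite u0 dot0v ltxx.
have eta0 : 0 < - dotv u nu / (2 * enorm u).
  by rewrite divr_gt0 ?oppr_gt0// mulr_gt0.
have /nbhs_enormP[e e0 eO] := cone _ eta0.
pose t := Num.min (e / (2 * enorm u)) (D * dotv u g / dotv u u).
have uu0 : 0 < dotv u u by rewrite -sqr_enorm exprn_gt0.
have t0 : 0 < t by rewrite lt_min !divr_gt0// mulr_gt0.
have te : t * enorm u < e.
  have : t <= e / (2 * enorm u) by rewrite ge_min lexx.
  by rewrite ler_pdivlMr ?mulr_gt0//; lra.
have tD : t * dotv u u <= D * dotv u g.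
  by rewrite -ler_pdivlMr// ge_min lexx orbT.
have tuE : enorm (xs + t *: u - xs) = t * enorm u.
  by rewrite addrAC subrr add0r enormZ gtr0_norm.
have [] := eO (xs + t *: u) ltac:(by rewrite tuE).
rewrite tuE => _; rewrite addrAC subrr add0r dotvZl => /(_ _) H.
have : ~ Omega (xs + t *: u).
  apply: H; rewrite (_ : - _ = t * (dotv u nu / 2)); last first.
    by field; rewrite gt_eqF.
  by rewrite ltr_pM2l//; lra.
move=> /(dist_to_frontier_le oO Ox); rewrite -/D leNgt => /negP; apply.
rewrite enorm_ball// opprD addrA gE.
move: (g) (u) g1 ug tD => g' u' g'1 ug' tD'.
rewrite !dotvE -(sqr_enorm g') g'1 (dotvC g' u') expr1n.
have : t * dotv u' u' < 2 * D * dotv u' g' by have := mulr_gt0 D0 ug'; lra.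
by rewrite -(ltr_pM2l t0); lra.
Qed.

(** Within distance [r] of [x], the frontier of [Omega] deviates from the tangent
    plane at the nearest boundary point by at most [r ^+ 2 / rad]: it lies between
    two tangent balls. Their radius [3 / 4 * rad] is less than the reach, and exceeds
    [rad / 2] by enough to absorb the square of the distance to the tangent plane,
    which is at most [2 * r <= rad / 2]. *)
Lemma domain_between_slabs Omega x nu rad (r : R) (delta := dist_to x (frontier Omega)) :
  open Omega -> (rad%:E <= reach Omega)%E -> (rad%:E <= reach (~` Omega))%E ->
  Omega x -> normal_at Omega x nu -> 0 < r -> 4 * r <= rad -> delta <= r ->
  forall y, enorm (y - x) < r ->
    (r ^+ 2 / rad < dotv (y - x) nu + delta -> Omega y) /\
    (dotv (y - x) nu + delta < - (r ^+ 2 / rad) -> ~ Omega y).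
Proof.
move=> oO rO rC Ox [xs nxs inw] r0 rrad deltar y yr.
have [delta0 xxs] := frontier_nearest_normal oO Ox nxs inw.
rewrite -/delta in delta0 xxs.
have [nu1 cone] := inw.
have rad0 : 0 < rad by lra.
have srad : 0 < 3 / 4 * rad < rad by apply/andP; split; lra.
have [clxs Oxs] : (closure Omega `\` Omega) xs by rewrite -open_frontierE; case: nxs.
set z := dotv (y - x) nu.
have yE (k : R) : dotv (xs + k *: nu - y) (xs + k *: nu - y) =
    dotv (y - x) (y - x) + 2 * delta * z + delta ^+ 2 - 2 * k * (z + delta) + k ^+ 2.
  have -> : xs + k *: nu - y = (k - delta) *: nu - (y - x).
    have -> : x = xs + delta *: nu by rewrite -xxs addrC subrK.
    by apply/rowP => i; rewrite !mxE; ring.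
  rewrite /z; move: (y - x) => w.
  by rewrite !dotvE -(sqr_enorm nu) nu1 (dotvC nu w); ring.
have zr : z ^+ 2 <= dotv (y - x) (y - x).
  rewrite -sqr_enorm -real_normK ?num_real// lerXn2r ?nnegrE ?enorm_ge0//.
  by have := normr_dotv_le (y - x) nu; rewrite nu1 mulr1.
have yr2 : dotv (y - x) (y - x) < r ^+ 2 by rewrite -enorm_ball.
have : `|z| < r.
  apply: le_lt_trans yr.
  by have := normr_dotv_le (y - x) nu; rewrite nu1 mulr1.
rewrite ltr_norml => /andP[zr1 zr2].
have s0 : 0 < 3 / 4 * rad by lra.
split.
  rewrite ltr_pdivrMr// => h; apply: contrapT => Oy.
  have : 3 / 4 * rad <= enorm (xs + (3 / 4 * rad) *: nu - y).
    apply: (@reach_tangent_ball (~` Omega) xs nu rad) => //.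
      exact: subset_closure.
    move=> eta eta0; have := cone eta eta0; apply: filterS => w [w1 _] Ow.
    by rewrite leNgt; apply/negP => /w1.
  rewrite leNgt => /negP; apply; rewrite enorm_ball// yE.
  have : 0 < z + delta by nra.
  nra.
rewrite -mulNr ltr_pdivlMr// => h Oy.
have : 3 / 4 * rad <= enorm (xs + (3 / 4 * rad) *: (- nu) - y).
  apply: (@reach_tangent_ball Omega xs (- nu) rad) => //.
    by rewrite enormN.
  move=> eta eta0; have := cone eta eta0; apply: filterS => w [_ w1] Ow.
  by rewrite dotvNr leNgt; apply/negP => h'; apply: w1 Ow; rewrite ltrNr.
rewrite leNgt => /negP; apply; rewrite enorm_ball// scalerN -scaleNr yE.
have : z + delta < 0 by nra.
nra.
Qed.

End tangent_balls.

(** * Translations and uniqueness of Lebesgue measure *)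

Section lebesgue_measure_1d.
Context {R : realType}.
Local Notation leb := (@lebesgue_measure R).

Lemma measurable_addr (c : R) :
  measurable_fun setT (fun x : measurableTypeR R => x + c : measurableTypeR R).
Proof. by apply: measurable_funD. Qed.

Lemma lebesgue_measure_translate (c : R) (A : set (measurableTypeR R)) :
  measurable A -> leb ((fun x => x + c) @^-1` A) = leb A.
Proof.
move=> mA; apply/esym.
pose mu := measure_function_pushforward__canonical__measure_function_Measure
  leb (measurable_addr c).
apply: (@lebesgue_measure_unique _ mu _ A mA) => _ [[a b] _ <-] /=.
rewrite /mu/= /pushforward.
rewrite (_ : _ @^-1` _ = `]a - c, b - c]%classic); last first.
  by apply/seteqP; split => x /=; rewrite !in_itv/= ltrBlDr lerBrDr.
by rewrite !lebesgue_measure_itv/= !lte_fin ltrD2r -EFinB -EFinB opprB addrA subrK.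
Qed.

End lebesgue_measure_1d.

Section lebesgue_measure_rV.
Context {R : realType}.
Local Notation leb := (@lebesgue_measure R).

Lemma rV_cons0 d (x : R) (v : 'rV[R]_d) : rV_cons (x, v) ord0 ord0 = x.
Proof. by rewrite mxE unlift_none. Qed.

Lemma measurable_addv d (c : 'rV[R]_d) : 
  measurable_fun setT (fun x : 'rV[R]_d => x + c).
Proof.
apply: measurable_fun_rVP => i; under eq_fun do rewrite mxE.
by apply: measurable_funD => //; exact: measurable_rV_coord.
Qed.

Lemma lebesgue_rV_translate d (c : 'rV[R]_d) (A : set 'rV[R]_d) :
  measurable A -> lebesgue_rV d ((fun x : 'rV[R]_d => x + c) @^-1` A) = lebesgue_rV d A.
Proof.
elim: d c A => [|d IH] c A mA.
  rewrite /= !diracE; congr ((_ : bool)%:R%:E).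
  apply/idP/idP; rewrite !inE /=; rewrite (_ : 0 + c = 0)//.
  - by apply/rowP => -[].
  - by apply/rowP => -[].
pose m2 := lebesgue_rV (R := R) d.
pose T (xv : measurableTypeR R * 'rV[R]_d) : measurableTypeR R * 'rV[R]_d :=
  (xv.1 + c ord0 ord0, xv.2 + rV_behead c).
have mT : measurable_fun setT T.
  apply/measurable_fun_pairP; split.
    exact: (measurableT_comp (measurable_addr _) measurable_fst).
  exact: (measurableT_comp (measurable_addv _) measurable_snd).
pose mu := measure_function_pushforward__canonical__measure_function_Measure
  (leb \x m2)%E mT.
have muE := @product_measure_unique _ _ _ _ R leb m2 mu.
rewrite /= /cons_measure /pushforward.
rewrite [RHS]muE; last 2 first.
- move=> A1 A2 mA1 mA2; rewrite /mu/= /pushforward.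
  rewrite (_ : _ @^-1` _ = ((fun x => x + c ord0 ord0) @^-1` A1) `*`
    ((fun x => x + rV_behead c) @^-1` A2)); last by apply/seteqP; split.
  rewrite product_measure1E//.
  + by rewrite [X in (X * _)%E](lebesgue_measure_translate _ mA1) [X in (_ * X)%E](IH _ _ mA2).
  + by rewrite -[X in measurable X]setTI; exact: measurable_addr.
  + by rewrite -[X in measurable X]setTI; exact: measurable_addv.
- by rewrite -[X in measurable X]setTI; exact: measurable_rV_cons.
rewrite /mu/= /pushforward; congr ((leb \x m2)%E _).
apply/seteqP; split => -[x v] /=;
  rewrite (_ : rV_cons (x, v) + c = rV_cons (T (x, v)))//;
  apply/rowP => i; rewrite !mxE; case: unliftP => [j ->|->]//=;
  by rewrite !mxE.
Qed.

Definition box d (a b : R) : set 'rV[R]_d := [set v | forall i, a <= v ord0 i < b].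

Lemma measurable_box d a b : measurable (box a b : set 'rV[R]_d).
Proof.
have -> : (box a b : set 'rV[R]_d) =
      \bigcap_(i in [set: 'I_d]) ((fun v => v ord0 i) @^-1` `[a, b[).
  apply/seteqP; split => v /= h i; first by move=> _ /=; rewrite in_itv; exact: h.
  by have := h i I; rewrite /= in_itv.
apply: fin_bigcap_measurable => // i _.
rewrite -[X in measurable X]setTI; apply: measurable_rV_coord => //.
Qed.

Lemma lebesgue_rV_box d (a b : R) :
  a <= b -> lebesgue_rV d (box a b) = ((b - a) ^+ d)%:E.
Proof.
move=> ab; elim: d => [|d IH].
  by rewrite /= diracE expr0 mem_set// => -[].
rewrite /= /cons_measure /pushforward.
rewrite (_ : _ @^-1` _ = `[a, b[%classic `*` (box a b : set 'rV[R]_d)); last first.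
  apply/seteqP; split => -[x v] /= => [h|[xab vab] i].
    split; first by have := h ord0; rewrite rV_cons0 in_itv.
    by move=> i; have := h (lift ord0 i); rewrite mxE liftK.
  rewrite mxE; case: (unliftP ord0 i) => [j _|_] /=; first exact: vab.
  by move: xab; rewrite in_itv.
rewrite product_measure1E//; last exact: measurable_box.
rewrite [X in (_ * X)%E]IH; move: ab; rewrite le_eqVlt => /predU1P[->|ab].
  by rewrite set_itvco0 measure0 mul0e subrr expr0n.
by rewrite [X in (X * _)%E]lebesgue_measure_itv/= lte_fin ab -EFinB -EFinM exprS.
Qed.

End lebesgue_measure_rV.

(** Two translation invariant measures are proportional: both sides are the
    measure under [mu \x la] of the pairs [(x, y)] with [x] in [A] and [x + y] in
    [B], for the left-hand side, and of the pairs with [x - y] in [A] and [x] in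
    [B], for the right-hand side, which are exchanged by a translation of [x]. *)
Lemma translation_invariant_proportional {R : realType} {d : nat}
    (mu la : {sigma_finite_measure set 'rV[R]_d -> \bar R}) :
  (forall (c : 'rV[R]_d) A, measurable A -> mu ((fun x => x + c) @^-1` A) = mu A) ->
  (forall (c : 'rV[R]_d) A, measurable A -> la ((fun x => x + c) @^-1` A) = la A) ->
  forall A B, measurable A -> measurable B ->
  (mu A * la B = mu B * la (-%R @^-1` A))%E.
Proof.
move=> muT laT A B mA mB.
pose E1 : set ('rV[R]_d * 'rV[R]_d) := [set z | A z.1 /\ B (z.1 + z.2)].
pose E2 : set ('rV[R]_d * 'rV[R]_d) := [set z | B z.1 /\ A (z.1 - z.2)].
have mfst : measurable_fun setT (fst : 'rV[R]_d * 'rV[R]_d -> 'rV[R]_d).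
  exact: measurable_fst.
have mD (s : R) :
    measurable_fun setT (fun z : 'rV[R]_d * 'rV[R]_d => z.1 + s *: z.2).
  apply: measurable_fun_rVP => i; under eq_fun do rewrite !mxE.
  apply: measurable_funD.
    exact: (measurableT_comp (measurable_rV_coord i) measurable_fst).
  apply: measurable_funM => //.
  exact: (measurableT_comp (measurable_rV_coord i) measurable_snd).
have mE1 : measurable E1.
  rewrite (_ : E1 = (fst @^-1` A) `&` ((fun z => z.1 + 1 *: z.2) @^-1` B)).
    apply: measurableI; rewrite -[X in measurable X]setTI; first exact: mfst.
    exact: mD.
  by apply/seteqP; split => z /=; rewrite scale1r.
have mE2 : measurable E2.
  rewrite (_ : E2 = (fst @^-1` B) `&` ((fun z => z.1 + (-1) *: z.2) @^-1` A)).
    apply: measurableI; rewrite -[X in measurable X]setTI; first exact: mfst.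
    exact: mD.
  by apply/seteqP; split => z /=; rewrite scaleN1r.
have mN : measurable_fun setT (-%R : 'rV[R]_d -> 'rV[R]_d).
  apply: measurable_fun_rVP => i; under eq_fun do rewrite mxE.
  by apply: measurableT_comp => //; exact: measurable_rV_coord.
have tonelli (E : set ('rV[R]_d * 'rV[R]_d)) : measurable E ->
    (\int[mu]_x la (xsection E x) = \int[la]_y mu (ysection E y))%E.
  move=> mE; 
  have mfE : measurable_fun setT (fun z : 'rV[R]_d * 'rV[R]_d => (\1_E z : R)%:E).
    by apply/measurable_EFinP; exact: measurable_indic.
  have f0 z : (0 <= (\1_E z : R)%:E)%E by rewrite lee_fin.
  have := @fubini_tonelli _ _ _ _ _ mu la _ mfE f0.
  under eq_integral => x _.
    rewrite (_ : (fun y => _) = EFin \o \1_(xsection E x)).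
      rewrite integral_indic ?setIT//; last exact: measurable_xsection.
      over.
    by apply/funext => y /=; rewrite !indicE -mem_xsection.
  move=> ->; apply: eq_integral => y _.
  rewrite (_ : (fun x => _) = EFin \o \1_(ysection E y)).
    by rewrite integral_indic ?setIT//; exact: measurable_ysection.
  by apply/funext => x /=; rewrite !indicE -mem_ysection.
have intc (m : {sigma_finite_measure set 'rV[R]_d -> \bar R})
    (S : set 'rV[R]_d) (c : \bar R)
    (F : 'rV[R]_d -> \bar R) : measurable S -> (0 <= c)%E ->
    (forall x, F x = if x \in S then c else 0%E) -> (\int[m]_x F x = m S * c)%E.
  move=> mS c0 FE; rewrite (eq_integral (fun x => c * (\1_S x)%:E)%E).
    rewrite ge0_integralZl//; last exact/measurable_EFinP/measurable_indic.
    by rewrite integral_indic// setIT muleC.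
  by move=> x _; rewrite FE indicE; case: ifP; rewrite ?mule1 ?mule0.
have -> : (mu A * la B = \int[mu]_x la (xsection E1 x))%E.
  apply/esym/intc => // x; case: ifPn => [|/negP]; rewrite inE => xA.
    rewrite -(laT x B mB); congr (la _); apply/seteqP; split => y /=.
      by rewrite /xsection/= inE => -[_] /=; rewrite addrC.
    by rewrite /xsection/= inE addrC.
  rewrite (_ : xsection E1 x = set0) ?measure0//.
  by apply/seteqP; split => y //=; rewrite /xsection/= inE => -[].
have -> : (mu B * la (-%R @^-1` A) = \int[mu]_x la (xsection E2 x))%E.
  apply/esym/intc => // x; case: ifPn => [|/negP]; rewrite inE => xB.
    have mNA : measurable ((-%R : 'rV[R]_d -> _) @^-1` A).
      by rewrite -[X in measurable X]setTI; exact: mN.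
    rewrite -(laT (- x) _ mNA); congr (la _); apply/seteqP; split => y /=.
      by rewrite /xsection/= inE => -[_] /=; rewrite opprD opprK addrC.
    by rewrite /xsection/= inE opprD opprK addrC => ?; split.
  rewrite (_ : xsection E2 x = set0) ?measure0//.
  by apply/seteqP; split => y //=; rewrite /xsection/= inE => -[].
rewrite !tonelli//; apply: eq_integral => y _.
have mS : measurable (ysection E1 y) by exact: measurable_ysection.
rewrite -(muT (- y) _ mS); congr (mu _).
by apply/seteqP; split => x; rewrite /ysection/= => /set_mem h; apply/mem_set;
  move: h; rewrite /E1 /E2 /= subrK => -[].
Qed.

(** * Reflections, scaling and balls *)

Section measurable_euclidean.
Context {R : realType} {d : nat}.
Implicit Types (x u : 'rV[R]_d).

Lemma measurable_dotv u : measurable_fun setT (fun x => dotv x u).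
Proof.
apply: measurable_sum => i; apply: measurable_funM => //.
exact: measurable_rV_coord.
Qed.

Lemma measurable_enorm : measurable_fun setT (enorm : 'rV[R]_d -> R).
Proof.
have : measurable_fun setT (fun x => dotv x x).
  by apply: measurable_sum => i; apply: measurable_funM; exact: measurable_rV_coord.
apply: measurableT_comp; apply: continuous_measurable_fun.
exact: sqrt_continuous.
Qed.

Lemma measurable_eball x (r : R) : measurable (eball x r).
Proof.
rewrite (_ : eball x r = (fun y => enorm (y + - x)) @^-1` `]-oo, r[); last first.
  by apply/seteqP; split => y /=; rewrite in_itv.
rewrite -[X in measurable X]setTI; apply: measurableT_comp => //.
  exact: measurable_enorm.
exact: measurable_addv.
Qed.

End measurable_euclidean.

Section linear_invariance.
Context {R : realType} {d : nat}.
Local Notation la := (lebesgue_rV (R := R) d).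

Section additive_bijection.
Variables (f g : 'rV[R]_d -> 'rV[R]_d).
Hypotheses (mf : measurable_fun setT f) (mg : measurable_fun setT g).
Hypotheses (fK : cancel f g) (gK : cancel g f) (fD : {morph f : x y / x + y}).

Let image_measure : set 'rV[R]_d -> \bar R := pushforward la f.

HB.instance Definition _ := Measure.copy image_measure
  (measure_function_pushforward__canonical__measure_function_Measure la mf).

Let image_sigma_finite : sigma_finite setT image_measure.
Proof.
have /sigma_finiteP[F [UF ndF Foo]] := sigma_finiteT la.
exists (fun k => g @^-1` F k).
  apply/esym; rewrite -subTset => x _.
  have [i _ Fi] : (\bigcup_k F k) (g x) by rewrite -UF.
  by exists i.
move=> k; have [mFk Fk] := Foo k; split.
  by rewrite -[X in measurable X]setTI; exact: mg.
rewrite /image_measure /pushforward (_ : _ @^-1` _ = F k)//.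
by apply/seteqP; split => x /=; rewrite fK.
Qed.

HB.instance Definition _ := Measure_isSigmaFinite.Build _ _ _ image_measure
  image_sigma_finite.

Lemma lebesgue_rV_additive_bij A B : measurable A -> measurable B ->
  (la (f @^-1` A) * la B = la (f @^-1` B) * la (-%R @^-1` A))%E.
Proof.
apply: (@translation_invariant_proportional _ _ image_measure la).
  move=> c C mC; rewrite /image_measure /pushforward.
  have mfC : measurable (f @^-1` C) by rewrite -[X in measurable X]setTI; exact: mf.
  apply: etrans (lebesgue_rV_translate (g c) mfC).
  congr (la _); apply/seteqP; split => x /=.
  - by rewrite fD gK.
  - by rewrite fD gK.
exact: lebesgue_rV_translate.
Qed.

End additive_bijection.

Lemma lebesgue_rV_opp (A : set 'rV[R]_d) :
  measurable A -> la (-%R @^-1` A) = la A.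
Proof.
move=> mA; have := @lebesgue_rV_additive_bij id id (@measurable_id _ _ _)
  (@measurable_id _ _ _) (fun=> erefl) (fun=> erefl) (fun _ _ => erefl)
  A (box 0 1) mA (measurable_box _ _).
by rewrite !preimage_id lebesgue_rV_box// subr0 expr1n mule1 mul1e => ->.
Qed.

Lemma lebesgue_rV_scale (k : R) (A : set 'rV[R]_d) : 0 < k -> measurable A ->
  la A = ((k ^+ d)%:E * la ( *:%R k @^-1` A))%E.
Proof.
move=> k0 mA.
have mk (c : R) : measurable_fun setT ( *:%R c : 'rV[R]_d -> 'rV[R]_d).
  apply: measurable_fun_rVP => i; under eq_fun do rewrite mxE.
  by apply: measurable_funM => //; exact: measurable_rV_coord.
have := @lebesgue_rV_additive_bij ( *:%R k) ( *:%R k^-1) (mk _) (mk _)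
  (scalerK (lt0r_neq0 k0)) (scalerKV (lt0r_neq0 k0)) (scalerDr k)
  A (box 0 k) mA (measurable_box _ _).
rewrite lebesgue_rV_opp// (_ : *:%R k @^-1` box 0 k = box 0 1); last first.
  apply/seteqP; split => v /= h i; have := h i; rewrite mxE.
    by rewrite pmulr_rge0// -[X in _ < X]mulr1 ltr_pM2l.
  by rewrite pmulr_rge0// -[X in _ -> _ && (_ < X)]mulr1 ltr_pM2l.
by rewrite !lebesgue_rV_box ?ltW// !subr0 expr1n mul1e muleC => ->.
Qed.

Lemma lebesgue_rV_eball01_fin_gt0 : (0 < la (eball 0 1) < +oo)%E.
Proof.
apply/andP; split.
  apply: (@lt_le_trans _ _ (la (box 0 d.+1%:R^-1))).
    by rewrite lebesgue_rV_box ?invr_ge0// subr0 lte_fin exprn_gt0// invr_gt0.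
  rewrite le_measure ?inE//; [exact: measurable_box|exact: measurable_eball|].
  move=> v vb; rewrite /eball/= subr0 enorm_ball// expr1n.
  apply: (@le_lt_trans _ _ (\sum_(i < d) d.+1%:R^-1)).
    apply: ler_sum => i _; have /andP[v0 v1] := vb i.
    rewrite -[leRHS]mulr1 ler_pM// (le_trans (ltW v1))//.
    by rewrite invf_le1 ?ltr0n// ler1n.
  rewrite sumr_const card_ord -[X in X < _]mulr_natl ltr_pdivrMr ?ltr0n// mul1r.
  by rewrite ltr_nat.
apply: (@le_lt_trans _ _ (la (box (-1) 1))).
  rewrite le_measure ?inE//; [exact: measurable_eball|exact: measurable_box|].
  move=> v; rewrite /eball/= subr0 => v1 i.
  have := le_lt_trans (normr_coord_le_enorm v i) v1.
  by rewrite ltr_norml => /andP[/ltW -> ->].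
by rewrite lebesgue_rV_box ?ltry//; lra.
Qed.

Lemma omega_ball_gt0 : 0 < omega_ball R d.
Proof.
by rewrite /omega_ball fine_gt0 ?lebesgue_rV_eball01_fin_gt0.
Qed.

Lemma lebesgue_rV_eball x (r : R) : 0 < r ->
  la (eball x r) = (r ^+ d * omega_ball R d)%:E.
Proof.
move=> r0.
rewrite (_ : eball x r = (fun y => y + - x) @^-1` eball 0 r); last first.
  by apply/seteqP; split => y; rewrite /eball/= subr0.
rewrite lebesgue_rV_translate; last exact: measurable_eball.
rewrite (lebesgue_rV_scale r0); last exact: measurable_eball.
rewrite (_ : _ @^-1` _ = eball 0 1); last first.
  apply/seteqP; split => y; rewrite /eball/= !subr0 enormZ gtr0_norm//.
    by rewrite -[X in _ < X]mulr1 ltr_pM2l.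
  by rewrite -[X in _ -> _ < X]mulr1 ltr_pM2l.
rewrite EFinM /omega_ball fineK//.
by have /andP[la0 laoo] := lebesgue_rV_eball01_fin_gt0; rewrite ge0_fin_numE ?ltW.
Qed.

(** Under the conditions on [a], [b] and [u] below this is an isometric involution:
    the central symmetry ([a = -1], [b = 0]), the reflection across the line of [u]
    ([a = -1]) or the one across the hyperplane orthogonal to [u] ([a = 1]). *)
Definition householder (a b : R) (u x : 'rV[R]_d) : 'rV[R]_d :=
  a *: x + (b * dotv x u) *: u.

Section householder.
Variables (a b : R) (u : 'rV[R]_d).
Hypotheses (a2 : a ^+ 2 = 1) (ab : 2 * a * b + b ^+ 2 * dotv u u = 0).

Lemma measurable_householder : measurable_fun setT (householder a b u).
Proof.
apply: measurable_fun_rVP => i; under eq_fun do rewrite !mxE.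
apply: measurable_funD; apply: measurable_funM => //.
  exact: measurable_rV_coord.
by apply: measurable_funM => //; exact: measurable_dotv.
Qed.

Lemma householderK : involutive (householder a b u).
Proof.
move=> x; rewrite /householder.
rewrite scalerDr !scalerA -expr2 a2 scale1r -addrA -scalerDl !dotvE.
rewrite (_ : _ + _ = (2 * a * b + b ^+ 2 * dotv u u) * dotv x u); last by ring.
by rewrite ab mul0r scale0r addr0.
Qed.

Lemma enorm_householder x : enorm (householder a b u x) = enorm x.
Proof.
rewrite /enorm /householder !dotvE (dotvC u x); congr Num.sqrt.
rewrite (_ : _ + _ = a ^+ 2 * dotv x x +
  (2 * a * b + b ^+ 2 * dotv u u) * dotv x u ^+ 2); last by ring.
by rewrite a2 ab mul1r mul0r addr0.
Qed.

(** The measure of the unit ball fixes the factor of proportionality. *)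
Lemma lebesgue_rV_householder A : measurable A -> la (householder a b u @^-1` A) = la A.
Proof.
move=> mA.
have fD : {morph householder a b u : x y / x + y}.
  by move=> x y; rewrite /householder scalerDr dotvDl mulrDr scalerDl addrACA.
have := lebesgue_rV_additive_bij measurable_householder measurable_householder
  householderK householderK fD mA (measurable_eball 0 1).
rewrite lebesgue_rV_opp// (_ : _ @^-1` eball 0 1 = eball 0 1); last first.
  by apply/seteqP; split => x; rewrite /eball/= !subr0 enorm_householder.
have /andP[la0 laoo] := lebesgue_rV_eball01_fin_gt0.
have lafin : la (eball 0 1) \is a fin_num by rewrite ge0_fin_numE// ltW.
rewrite muleC => laE; apply/eqP; rewrite eq_le.
by apply/andP; split; rewrite -(lee_pmul2l lafin la0) laE.
Qed.

End householder.

End linear_invariance.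

(** * Moments over balls *)

Section half_ball_integral_1d.
Context {R : realType}.
Local Notation leb := (@lebesgue_measure R).

(** [- Num.sqrt (r ^+ 2 - z ^+ 2) ^+ k.+2 / k.+2] is a primitive; at [z = r] it is
    only continuous. *)
Lemma integral_mul_sqrt_pow (k : nat) (delta r : R) : 0 < delta < r ->
  (\int[leb]_(z in `[delta, r])
     (z * Num.sqrt (r ^+ 2 - z ^+ 2) ^+ k)%:E =
   (Num.sqrt (r ^+ 2 - delta ^+ 2) ^+ k.+2 / k.+2%:R)%:E)%E.
Proof.
move=> /andP[delta0 deltar].
pose h (z : R) : R := Num.sqrt (r ^+ 2 - z ^+ 2).
pose F (z : R) : R := - (h z ^+ k.+2 / k.+2%:R).
have ch : continuous h.
  move=> z; apply: continuous_comp; last exact: sqrt_continuous.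
  apply: cvgB; first exact: cvg_cst.
  exact: exprn_continuous.
have chX m : continuous (fun z => h z ^+ m).
  move=> z; apply: (@continuous_comp _ _ _ h (fun x => x ^+ m)); first exact: ch.
  exact: exprn_continuous.
have cF : continuous F.
  by move=> z; apply: cvgN; apply: cvgM; [exact: chX|exact: cvg_cst].
have dF z : delta < z < r -> is_derive z 1 F (z * h z ^+ k).
  move=> /andP[dz zr].
  have rz0 : 0 < r ^+ 2 - z ^+ 2 by rewrite subr_gt0; nra.
  have dh : is_derive z 1 h (- z / h z).
    have dq : is_derive z (1 : R) (fun z : R => r ^+ 2 - z ^+ 2) (- (2 * z)).
      by apply: is_derive_eq; rewrite -[z%:A]/(z * 1) mulr1; ring.
    have dh := @is_derive1_comp _ Num.sqrt (fun z : R => r ^+ 2 - z ^+ 2) _ _ _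
      (is_derive1_sqrt rz0) dq.
    have -> : - z / h z = (2 * Num.sqrt (r ^+ 2 - z ^+ 2))^-1 * - (2 * z).
      by rewrite /h; field; rewrite gt_eqF// sqrtr_gt0.
    exact: dh.
  have := is_deriveX k.+1 dh => dX.
  have h0 : h z != 0 by rewrite gt_eqF// sqrtr_gt0.
  have -> : F = (- k.+2%:R^-1) \*: (h ^+ k.+2).
    apply/funext => x; rewrite /F /= -[RHS]/(_ * _) mulNr mulrC.
    by congr (- (_ * _)); rewrite fctE.
  apply: is_derive_eq; rewrite -[X in X = _]/(_ * _) -[X in _ * X]/(_ * _).
  rewrite exprS; field.
  by rewrite h0 ?andbT /= gt_eqF//; have := ler0n R k; lra.
rewrite (@continuous_FTC2 _ _ F)//.
- by rewrite /F /h subrr sqrtr0 expr0n/= mul0r oppr0 -EFinB sub0r opprK.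
- apply: continuous_subspaceT => z; apply: cvgM; first exact: cvg_id.
  exact: chX.
- split.
  + by move=> z; rewrite in_itv/= => /dF[].
  + by apply: cvg_at_right_filter; exact: cF.
  + by apply: cvg_at_left_filter; exact: cF.
- by move=> z; rewrite in_itv/= => /dF dz; rewrite derive1E derive_val.
Qed.

End half_ball_integral_1d.

Section ball_integrals.
Context {R : realType} {d : nat}.
Local Notation la := (lebesgue_rV (R := R) d).

Lemma integrable_eball x0 (r M : R) (phi : 'rV[R]_d -> R) : 0 < r ->
  measurable_fun setT phi -> (forall x, eball x0 r x -> `|phi x| <= M) ->
  la.-integrable (eball x0 r) (EFin \o phi).
Proof.
move=> r0 mphi phiM; apply: measurable_bounded_integrable.
- exact: measurable_eball.
- by rewrite [X in (X < _)%E]lebesgue_rV_eball// ltry.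
- exact: measurable_funTS.
- exists M; split => [|N MN x xB]; first exact: num_real.
  by apply: le_trans (phiM _ xB) _; exact: ltW.
Qed.

Lemma Rintegral_measure_preserving (f : 'rV[R]_d -> 'rV[R]_d) D
    (phi : 'rV[R]_d -> R) :
  measurable_fun setT f -> (forall A, measurable A -> la (f @^-1` A) = la A) ->
  measurable D -> measurable_fun setT phi ->
  la.-integrable (f @^-1` D) (EFin \o (phi \o f)) ->
  \int[la]_(x in D) phi x = \int[la]_(x in f @^-1` D) phi (f x).
Proof.
move=> mf fla mD mphi iphi.
rewrite /Rintegral; congr fine.
pose mu := measure_function_pushforward__canonical__measure_function_Measure la mf.
rewrite (@eq_measure_integral _ _ _ D mu la (EFin \o phi)); last first.
  by move=> A mA _; rewrite /mu/= /pushforward fla.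
have mphi' : measurable_fun setT (EFin \o phi) by exact/measurable_EFinP.
exact: (integral_pushforward mf mphi' iphi mD).
Qed.

Lemma Rintegral_eball_translate x0 (r M : R) (phi : 'rV[R]_d -> R) : 0 < r ->
  measurable_fun setT phi -> (forall x, eball x0 r x -> `|phi x| <= M) ->
  \int[la]_(x in eball x0 r) phi x = \int[la]_(x in eball 0 r) phi (x + x0).
Proof.
move=> r0 mphi phiM.
have E : (fun x => x + x0) @^-1` eball x0 r = eball 0 r.
  by apply/seteqP; split => x; rewrite /eball/= addrK subr0.
have iphi : la.-integrable (eball 0 r) (EFin \o (fun x => phi (x + x0))).
  apply: (@integrable_eball _ _ M) => //.
    by apply: measurableT_comp => //; exact: measurable_addv.
  by move=> x; rewrite -E => /phiM.
rewrite -E in iphi *.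
apply: Rintegral_measure_preserving iphi => //.
- exact: measurable_addv.
- by move=> A mA; rewrite lebesgue_rV_translate.
- exact: measurable_eball.
Qed.

Lemma Rintegral_eball_householder a b u (r M : R) (phi : 'rV[R]_d -> R) :
  a ^+ 2 = 1 -> 2 * a * b + b ^+ 2 * dotv u u = 0 -> 0 < r ->
  measurable_fun setT phi -> (forall x, eball 0 r x -> `|phi x| <= M) ->
  \int[la]_(x in eball 0 r) phi (householder a b u x) =
  \int[la]_(x in eball 0 r) phi x.
Proof.
move=> a2 ab r0 mphi phiM.
have E : householder a b u @^-1` eball 0 r = eball 0 r.
  by apply/seteqP; split => x; rewrite /eball/= !subr0 enorm_householder.
have iphi : la.-integrable (eball 0 r) (EFin \o (fun x => phi (householder a b u x))).
  apply: (@integrable_eball _ _ M) => //.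
    by apply: measurableT_comp => //; exact: measurable_householder.
  by move=> x; rewrite -E => /phiM.
rewrite -[X in integrable _ X]E in iphi.
transitivity (\int[la]_(x in householder a b u @^-1` eball 0 r)
  phi (householder a b u x)); first by rewrite E.
apply/esym; apply: Rintegral_measure_preserving iphi => //.
- exact: measurable_householder.
- by move=> A mA; rewrite lebesgue_rV_householder.
- exact: measurable_eball.
Qed.

Lemma normr_dotv_eball (e : 'rV[R]_d) (r : R) (x : 'rV[R]_d) :
  eball 0 r x -> `|dotv x e| <= r * enorm e.
Proof.
rewrite /eball/= subr0 => xr; apply: le_trans (normr_dotv_le _ _) _.
by rewrite ler_wpM2r ?enorm_ge0// ltW.
Qed.

End ball_integrals.

Section ball_moments.
Context {R : realType} {d' : nat}.
Local Notation d := d'.+1.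
Local Notation la := (lebesgue_rV (R := R) d).
Local Notation leb := (@lebesgue_measure R).
Variables (r : R) (psi : R -> R).
Hypotheses (r0 : 0 < r) (mpsi : measurable_fun setT psi).
Hypothesis psi1 : forall t, `|psi t| <= 1.
Implicit Types (x e nu : 'rV[R]_d).

Let mmom e nu : measurable_fun setT (fun x => dotv x e * psi (dotv x nu)).
Proof.
apply: measurable_funM; first exact: measurable_dotv.
by apply: measurableT_comp => //; exact: measurable_dotv.
Qed.

Let bmom e nu x : eball 0 r x -> `|dotv x e * psi (dotv x nu)| <= r * enorm e.
Proof.
move=> xr; rewrite normrM -[leRHS]mulr1 ler_pM//; exact: normr_dotv_eball.
Qed.

Lemma dotv_delta x : dotv x (delta_mx ord0 ord0) = x ord0 ord0.
Proof.
rewrite /dotv (bigD1 ord0)//= mxE !eqxx mulr1 big1 ?addr0// => i i0.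
by rewrite mxE (negbTE i0) andbF mulr0.
Qed.

(** Averaging over the reflection across the axis [nu] kills the component of the
    moment orthogonal to [nu]. *)
Lemma Rintegral_moment_axis e nu : enorm nu = 1 ->
  \int[la]_(x in eball 0 r) (dotv x e * psi (dotv x nu)) =
  dotv e nu * \int[la]_(x in eball 0 r) (dotv x nu * psi (dotv x nu)).
Proof.
move=> nu1; have nunu : dotv nu nu = 1 by rewrite -sqr_enorm nu1 expr1n.
set I := LHS.
have iphi e' : la.-integrable (eball 0 r)
    (EFin \o (fun x => dotv x e' * psi (dotv x nu))).
  exact: (integrable_eball r0 (mmom e' nu) (@bmom _ nu)).
have a2 : (-1 : R) ^+ 2 = 1 by rewrite sqrrN expr1n.
have ab : 2 * (-1 : R) * 2 + 2 ^+ 2 * dotv nu nu = 0 by rewrite nunu; ring.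
have IE : I = \int[la]_(x in eball 0 r)
    (2 * dotv e nu * (dotv x nu * psi (dotv x nu)) - dotv x e * psi (dotv x nu)).
  rewrite /I -(Rintegral_eball_householder a2 ab r0 (mmom e nu) (@bmom _ nu)).
  apply: eq_Rintegral => x _; rewrite /householder !dotvE nunu (dotvC nu e).
  rewrite (_ : -1 * dotv x nu + _ = dotv x nu); last by ring.
  by ring.
rewrite RintegralB// in IE; last 2 first.
- exact: measurable_eball.
- rewrite (_ : _ \o _ = fun x =>
    ((2 * dotv e nu)%:E * (dotv x nu * psi (dotv x nu))%:E)%E)//.
  by apply: integrableZl; [exact: measurable_eball|exact: iphi].
rewrite RintegralZl// in IE; last exact: measurable_eball.
by move: IE; rewrite -/I; lra.
Qed.

(** The hyperplane reflection exchanging the unit vector [nu] and the first basis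
    vector; it is the identity if they are equal, because then [w = 0]. *)
Definition to_axis nu : 'rV[R]_d -> 'rV[R]_d :=
  let w := nu - delta_mx ord0 ord0 in householder 1 (- (2 / dotv w w)) w.

Lemma to_axisP nu (w := nu - delta_mx ord0 ord0) : enorm nu = 1 ->
  2 * 1 * (- (2 / dotv w w)) + (- (2 / dotv w w)) ^+ 2 * dotv w w = 0 /\
  forall x, dotv (to_axis nu x) nu = x ord0 ord0.
Proof.
move=> nu1; have nunu : dotv nu nu = 1 by rewrite -sqr_enorm nu1 expr1n.
have wwE : dotv w w = 2 - 2 * nu ord0 ord0.
  rewrite /w !dotvE nunu dotv_delta dotv_delta mxE !eqxx dotvC dotv_delta.
  by rewrite /=; ring.
have [ww0|ww0] := eqVneq (dotv w w) 0.
  rewrite ww0 invr0 !mulr0 oppr0 !mulr0 addr0; split => // x.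
  rewrite /to_axis -/w /householder ww0 invr0 mulr0 oppr0 mul0r scale0r addr0 scale1r.
  have /subr0_eq -> : w = 0.
    by apply: enorm_eq0; apply/eqP; rewrite -sqrf_eq0 sqr_enorm ww0.
  by rewrite dotv_delta.
split; first by field.
move=> x.
have wnu : dotv w nu = dotv w w / 2.
  by rewrite wwE /w !dotvE nunu (dotvC _ nu) dotv_delta; field.
have xw : dotv x w = dotv x nu - x ord0 ord0.
  by rewrite /w dotvDr dotvNr dotv_delta.
rewrite /to_axis -/w /householder; move: ww0 wnu xw; move: (w) => w' ww0 wnu xw.
by rewrite dotvDl !dotvZl xw wnu; field.
Qed.

Lemma Rintegral_moment_rotate nu : enorm nu = 1 ->
  \int[la]_(x in eball 0 r) (dotv x nu * psi (dotv x nu)) =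
  \int[la]_(x in eball 0 r) (x ord0 ord0 * psi (x ord0 ord0)).
Proof.
move=> nu1; have [ab nuE] := to_axisP nu1.
rewrite -(Rintegral_eball_householder (expr1n _ _) ab r0 (mmom nu nu) (@bmom _ nu)).
by apply: eq_Rintegral => x _; rewrite -/(to_axis nu x) nuE.
Qed.

End ball_moments.

Section half_line_indicators.
Context {R : realType}.

Lemma measurable_lt_ind (a : R) : measurable_fun setT (fun t : R => (a < t)%R%:R : R).
Proof.
rewrite (_ : (fun t => _) = \1_(`]a, +oo[ : set R)).
  by apply: measurable_indic; exact: measurable_itv.
by apply/funext => t; rewrite indicE; congr (nat_of_bool _)%:R; apply/idP/idP;
  rewrite inE/= in_itv/= andbT.
Qed.

Lemma measurable_le_ind (a : R) : measurable_fun setT (fun t : R => (a <= t)%R%:R : R).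
Proof.
rewrite (_ : (fun t => _) = \1_(`[a, +oo[ : set R)).
  by apply: measurable_indic; exact: measurable_itv.
by apply/funext => t; rewrite indicE; congr (nat_of_bool _)%:R; apply/idP/idP;
  rewrite inE/= in_itv/= andbT.
Qed.

End half_line_indicators.

Section axial_integrals.
Context {R : realType} {d' : nat}.
Local Notation d := d'.+1.
Local Notation la := (lebesgue_rV (R := R) d).
Local Notation la' := (lebesgue_rV (R := R) d').
Local Notation leb := (@lebesgue_measure R).

Lemma dotv_cons (x : R) (v : 'rV[R]_d') :
  dotv (rV_cons (x, v)) (rV_cons (x, v)) = x ^+ 2 + dotv v v.
Proof.
rewrite {1}/dotv big_ord_recl rV_cons0 expr2; congr (_ + _).
by apply: eq_bigr => i _; rewrite !mxE liftK.
Qed.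

Lemma measurable_normr_le_slab (nu : 'rV[R]_d) (delta c : R) :
  measurable [set x : 'rV[R]_d | `|dotv x nu + delta| <= c].
Proof.
rewrite (_ : mkset _ = (fun x => `|dotv x nu + delta|) @^-1` `]-oo, c]); last first.
  by apply/seteqP; split => x /=; rewrite in_itv.
rewrite -[X in measurable X]setTI; apply: measurableT_comp => //.
by apply: measurable_funD => //; exact: measurable_dotv.
Qed.

(** After rotating [nu] to the first basis vector, the slab meets the ball in a
    subset of a cylinder over the ball of dimension [d - 1]. *)
Lemma lebesgue_rV_ball_slab (nu : 'rV[R]_d) (r delta c : R) :
  enorm nu = 1 -> 0 < r -> 0 <= c ->
  (la (eball 0 r `&` [set x | `|dotv x nu + delta| <= c]%R) <=
   (2 * c * (r ^+ d' * omega_ball R d'))%:E)%E.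
Proof.
move=> nu1 r0 c0; have [ab nuE] := to_axisP nu1.
have one2 : (1 : R) ^+ 2 = 1 by rewrite expr1n.
rewrite -(lebesgue_rV_householder one2 ab); last first.
  by apply: measurableI; [exact: measurable_eball|exact: measurable_normr_le_slab].
rewrite -/(to_axis nu).
pose I : set (measurableTypeR R) := `[- delta - c, - delta + c]%classic.
apply: (@le_trans _ _ ((leb \x la')%E (I `*` eball 0 r))).
  rewrite /= /cons_measure /pushforward le_measure ?inE//.
  - rewrite -[X in measurable X]setTI; apply: measurable_rV_cons => //.
    rewrite -[X in measurable X]setTI; apply: measurable_householder => //.
    by apply: measurableI; [exact: measurable_eball|exact: measurable_normr_le_slab].
  - by apply: measurableX; [exact: measurable_itv|exact: measurable_eball].
  - move=> -[x v] /= []; rewrite /eball/= subr0 enorm_householder//.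
    rewrite -/(to_axis nu (rV_cons (x, v))) nuE rV_cons0.
    rewrite enorm_ball// dotv_cons ler_norml => xv /andP[x1 x2]; split.
      by rewrite /I/= in_itv/=; apply/andP; split; lra.
    by rewrite subr0 enorm_ball//; have := sqr_ge0 x; lra.
have b0 : 0 <= r ^+ d' * omega_ball R d'.
  by rewrite mulr_ge0// ltW ?exprn_gt0 ?omega_ball_gt0.
rewrite [leLHS]product_measure1E; last 2 first.
- exact: measurable_itv.
- exact: measurable_eball.
rewrite [X in (_ * X)%E]lebesgue_rV_eball// [X in (X * _)%E]lebesgue_measure_itv/=.
rewrite lte_fin; case: ifPn => _.
  by rewrite -EFinD -EFinM lee_fin; apply: ler_wpM2r => //; lra.
by rewrite mul0e lee_fin mulr_ge0// mulr_ge0.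
Qed.

(** By Tonelli: the section of the ball at height [z] is a ball of dimension [d - 1]
    and of radius [Num.sqrt (r ^+ 2 - z ^+ 2)]. *)
Lemma Rintegral_ball_upper_axis (r delta : R) : 0 < delta < r ->
  \int[la]_(x in eball 0 r) (x ord0 ord0 * (delta <= x ord0 ord0)%R%:R) =
  omega_ball R d' * (Num.sqrt (r ^+ 2 - delta ^+ 2) ^+ d'.+2 / d'.+2%:R).
Proof.
move=> /[dup] deltar /andP[delta0 dr]; have r0 := lt_trans delta0 dr.
pose f (x : 'rV[R]_d) : \bar R :=
  (x ord0 ord0 * (delta <= x ord0 ord0)%R%:R * \1_(eball 0 r) x)%:E.
have mf : measurable_fun setT f.
  apply/measurable_EFinP; apply: measurable_funM.
    apply: measurable_funM; first exact: measurable_rV_coord.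
    exact: (measurableT_comp (measurable_le_ind delta) (measurable_rV_coord ord0)).
  by apply: measurable_indic; exact: measurable_eball.
have f0 x : (0 <= f x)%E.
  rewrite lee_fin mulr_ge0//; case: (leP delta (x ord0 ord0)) => h; last by rewrite mulr0.
  by rewrite mulr1 (le_trans _ h)// ltW.
have E : (\int[la]_x f x = \int[leb]_x \int[la']_v f (rV_cons (x, v)))%E.
  have mc : measurable_fun setT
      (@rV_cons R d' : measurableTypeR R * 'rV[R]_d' -> 'rV[R]_d).
    exact: measurable_rV_cons.
  transitivity (\int[(leb \x la')%E]_z (f \o @rV_cons R d') z)%E.
    have := ge0_integral_pushforward mc (leb \x la')%E measurableT mf (fun x _ => f0 x).
    rewrite preimage_setT; exact.
  rewrite fubini_tonelli1//; first exact: measurableT_comp.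
  by move=> x /=; exact: f0.
rewrite /Rintegral.
rewrite (_ : (\int[la]_(x in _) _)%E = (\int[la]_x f x)%E); last first.
  rewrite integral_mkcond; apply: eq_integral => x _.
  rewrite /f patchE indicE; case: ifPn => h; rewrite ?mulr1 ?mulr0//.
rewrite E (_ : (\int[leb]_x _)%E = (\int[leb]_(x in `[delta, r[)
    ((omega_ball R d')%:E * (x * Num.sqrt (r ^+ 2 - x ^+ 2) ^+ d')%:E))%E); last first.
  rewrite [RHS]integral_mkcond; apply: eq_integral => x _; rewrite patchE.
  case: ifPn => [|/negP]; rewrite inE/= in_itv/=.
    move=> /andP[dx xr].
    have rx : x ^+ 2 < r ^+ 2 by nra.
    have h0 : 0 < Num.sqrt (r ^+ 2 - x ^+ 2) by rewrite sqrtr_gt0 subr_gt0.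
    rewrite (eq_integral (fun v => x%:E * (\1_(eball 0 (Num.sqrt (r ^+ 2 - x ^+ 2))) v)%:E)%E).
      rewrite ge0_integralZl//; last 2 first.
      - by apply/measurable_EFinP; apply: measurable_indic; exact: measurable_eball.
      - by rewrite lee_fin; lra.
      rewrite integral_indic//; last exact: measurable_eball.
      rewrite setIT [X in (_ * X)%E]lebesgue_rV_eball// -!EFinM; congr _%:E; ring.
    move=> v _; rewrite /f rV_cons0 dx mulr1 -EFinM !indicE; congr (_ * (nat_of_bool _)%:R)%:E.
    apply/idP/idP; rewrite !inE /eball/= !subr0 !enorm_ball// dotv_cons;
      rewrite sqr_sqrtr ?subr_ge0 ?(ltW rx) => [?|]; lra.
  move=> dxr; apply: integral0_eq => v _; rewrite /f rV_cons0.
  case: (leP delta x) => dx; last by rewrite mulr0 mul0r.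
  rewrite indicE (_ : _ \in _ = false) ?mulr0//; apply/negP; rewrite inE.
  rewrite /eball/= subr0 enorm_ball// dotv_cons => h; apply: dxr.
  by rewrite dx/=; have := dotvv_ge0 v; nra.
have mg D : measurable_fun D
    (fun x : R => (x * Num.sqrt (r ^+ 2 - x ^+ 2) ^+ d')%:E).
  apply/measurable_funTS/measurable_EFinP; apply: measurable_funM => //.
  apply: measurable_funX; apply: measurableT_comp.
    by apply: continuous_measurable_fun; exact: sqrt_continuous.
  by apply: measurable_funB => //; exact: measurable_funX.
rewrite ge0_integralZl//; last 3 first.
- exact: mg.
- move=> x; rewrite /= in_itv/= => /andP[dx _]; rewrite lee_fin mulr_ge0//; lra.
- by rewrite lee_fin ltW ?omega_ball_gt0.
rewrite integral_itv_bndo_bndc; last exact: mg.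
by rewrite integral_mul_sqrt_pow.
Qed.

End axial_integrals.

(** * The mean of a density close to a half space *)

Section mean_bias.
Context {R : realType} {d' : nat}.
Local Notation d := d'.+1.
Local Notation la := (lebesgue_rV (R := R) d).

(** The slab [-delta < x ord0 ord0 < delta] contributes nothing, by symmetry. *)
Lemma Rintegral_ball_halfspace_axis (r delta : R) : 0 < delta < r ->
  \int[la]_(x in eball 0 r) (x ord0 ord0 * (- delta < x ord0 ord0)%R%:R) =
  omega_ball R d' * (Num.sqrt (r ^+ 2 - delta ^+ 2) ^+ d'.+2 / d'.+2%:R).
Proof.
move=> /[dup] deltar /andP[delta0 dr]; have r0 := lt_trans delta0 dr.
rewrite -Rintegral_ball_upper_axis//.
pose odd (t : R) : R := (- delta < t)%R%:R - (delta <= t)%R%:R.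
have modd : measurable_fun setT odd.
  by apply: measurable_funB; [exact: measurable_lt_ind|exact: measurable_le_ind].
have mi (psi : R -> R) : measurable_fun setT psi ->
    measurable_fun setT (fun x : 'rV[R]_d => x ord0 ord0 * psi (x ord0 ord0)).
  move=> mpsi; apply: measurable_funM; first exact: measurable_rV_coord.
  exact: (measurableT_comp mpsi (measurable_rV_coord ord0)).
have bi (psi : R -> R) : (forall t, `|psi t| <= 1) -> forall x : 'rV[R]_d,
    eball 0 r x -> `|x ord0 ord0 * psi (x ord0 ord0)| <= r.
  move=> psi1 x xr; rewrite normrM -[leRHS]mulr1 ler_pM//.
  move: xr; rewrite /eball/= subr0 => /ltW; apply: le_trans.
  exact: normr_coord_le_enorm.
have odd1 t : `|odd t| <= 1.
  by rewrite /odd; case: (ltP (- delta) t) => _; case: (leP delta t) => _;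
    rewrite ?subrr ?subr0 ?sub0r ?normrN ?normr0 ?normr1.
have upper1 t : `|(delta <= t)%R%:R : R| <= 1.
  by case: (leP delta t) => _; rewrite ?normr0 ?normr1.
have io := integrable_eball r0 (mi _ modd) (bi _ odd1).
have iu := integrable_eball r0 (mi _ (measurable_le_ind delta)) (bi _ upper1).
have a2 : (-1 : R) ^+ 2 = 1 by rewrite sqrrN expr1n.
have ab : 2 * (-1 : R) * 0 + 0 ^+ 2 * dotv (0 : 'rV[R]_d) 0 = 0.
  by rewrite expr0n/= !mulr0 mul0r addr0.
set I := LHS; set J := RHS.
pose Z := \int[la]_(x in eball 0 r) ((x : 'rV[R]_d) ord0 ord0 * odd (x ord0 ord0)).
have IJ : I = Z + J.
  rewrite /I /Z /J -RintegralD//; last exact: measurable_eball.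
  by apply: eq_Rintegral => x _; rewrite /odd; ring.
suff Z0 : Z = 0 by rewrite IJ Z0 add0r.
have : Z = -1 * Z.
  rewrite {1}/Z -(Rintegral_eball_householder a2 ab r0 (mi _ modd) (bi _ odd1)).
  rewrite /Z -RintegralZl//; last exact: measurable_eball.
  apply: eq_Rintegral => x _.
  rewrite /householder mul0r scale0r addr0 mxE mulN1r.
  rewrite mulNr mulN1r; congr (- (_ * _)); rewrite /odd ltrN2.
  by rewrite lerNr !ltNge; case: (leP (x ord0 ord0) (- delta)); case: (leP delta (x ord0 ord0));
    rewrite ?subrr ?subr0 ?sub0r//; lra.
lra.
Qed.

(** A density that is, up to [K], equal to [rho0] on a half space and to 0 off it,
    except in a slab of width [2 * c] about the boundary, has almost the first moment
    of the half ball. The latter is a multiple of the normal [nu]. *)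
Lemma mean_bias (rho : 'rV[R]_d -> R) (x0 nu e : 'rV[R]_d) (r delta c K rho0 : R) :
  enorm nu = 1 -> 0 < delta < r -> 0 <= c -> 0 <= K -> 0 <= rho0 ->
  measurable_fun setT rho ->
  (forall x, eball x0 r x ->
     `|rho x - rho0 * (- delta < dotv (x - x0) nu)%R%:R| <=
     K + rho0 * \1_[set x | `|dotv x nu + delta| <= c]%R (x - x0)) ->
  `|\int[la]_(x in eball x0 r) (dotv (x - x0) e * rho x) -
    rho0 * (omega_ball R d' * (Num.sqrt (r ^+ 2 - delta ^+ 2) ^+ d'.+2 / d'.+2%:R)) *
    dotv e nu| <=
  r * enorm e * (K * (r ^+ d * omega_ball R d) +
                 rho0 * (2 * c * (r ^+ d' * omega_ball R d'))).
Proof.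
move=> nu1 /[dup] deltar /andP[delta0 dr] c0 K0 rho00 mrho H.
have r0 := lt_trans delta0 dr.
pose S := [set x : 'rV[R]_d | `|dotv x nu + delta| <= c].
pose psi (t : R) : R := (- delta < t)%R%:R.
have mpsi : measurable_fun setT psi by exact: measurable_lt_ind.
have psi1 t : `|psi t| <= 1 by rewrite /psi; case: ltP => _; rewrite ?normr0 ?normr1.
have mS : measurable S by exact: measurable_normr_le_slab.
pose M := K + rho0 + rho0.
have rhoM x : eball x0 r x -> `|rho x| <= M.
  move=> /H h.
  have h1 : `|rho0 * (- delta < dotv (x - x0) nu)%R%:R| <= rho0.
    by rewrite normrM (ger0_norm rho00) -[leRHS]mulr1 ler_wpM2l//; exact: psi1.
  have h2 : rho0 * \1_S (x - x0) <= rho0.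
    by rewrite -[leRHS]mulr1 ler_wpM2l// indicE; case: (_ \in _).
  have := ler_normD (rho x - rho0 * (- delta < dotv (x - x0) nu)%R%:R)
    (rho0 * (- delta < dotv (x - x0) nu)%R%:R).
  by rewrite subrK /M; move: h h2; rewrite /S; lra.
have md : measurable_fun setT (fun x : 'rV[R]_d => dotv (x - x0) e).
  apply: (measurableT_comp (measurable_dotv e)); exact: measurable_addv.
rewrite (@Rintegral_eball_translate _ _ _ _ (r * enorm e * M))//; last 2 first.
- exact: measurable_funM.
- move=> x xr; rewrite normrM ler_pM ?rhoM// normr_dotv_eball//.
  by move: xr; rewrite /eball/= subr0.
under eq_Rintegral do rewrite addrK.
have B0x0 x : eball 0 r x -> eball x0 r (x + x0) by rewrite /eball/= addrK subr0.
rewrite -Rintegral_ball_halfspace_axis// -mulrA [_ * dotv e nu]mulrC.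
rewrite -(@Rintegral_moment_rotate _ _ _ psi r0 mpsi psi1 nu nu1).
rewrite -(@Rintegral_moment_axis _ _ _ psi r0 mpsi psi1 e nu nu1).
have m1 : measurable_fun setT (fun x : 'rV[R]_d => dotv x e * rho (x + x0)).
  apply: measurable_funM; first exact: measurable_dotv.
  exact: (measurableT_comp mrho (measurable_addv x0)).
have m2 : measurable_fun setT (fun x : 'rV[R]_d => rho0 * (dotv x e * psi (dotv x nu))).
  apply: measurable_funM => //; apply: measurable_funM; first exact: measurable_dotv.
  exact: (measurableT_comp mpsi (measurable_dotv nu)).
have b1 x : eball 0 r x -> `|dotv x e * rho (x + x0)| <= r * enorm e * M.
  by move=> xr; rewrite normrM ler_pM ?normr_dotv_eball// rhoM//; exact: B0x0.
have b2 x : eball 0 r x -> `|rho0 * (dotv x e * psi (dotv x nu))| <= rho0 * (r * enorm e).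
  move=> xr; rewrite normrM (ger0_norm rho00) ler_wpM2l// normrM -[leRHS]mulr1.
  by rewrite ler_pM// normr_dotv_eball.
have b3 x : eball 0 r x -> `|dotv x e * psi (dotv x nu)| <= r * enorm e.
  by move=> xr; rewrite normrM -[leRHS]mulr1 ler_pM// normr_dotv_eball.
have m3 : measurable_fun setT (fun x : 'rV[R]_d => dotv x e * psi (dotv x nu)).
  apply: measurable_funM; first exact: measurable_dotv.
  exact: (measurableT_comp mpsi (measurable_dotv nu)).
have mB : measurable (eball 0 r : set 'rV[R]_d) by exact: measurable_eball.
have i1 := integrable_eball r0 m1 b1.
have i2 := integrable_eball r0 m2 b2.
have i3 := integrable_eball r0 m3 b3.
rewrite -RintegralZl// -RintegralB//.
have i12 := integrableB mB i1 i2.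
apply: le_trans (le_normr_Rintegral mB i12) _.
have mSi : measurable_fun setT (\1_S : 'rV[R]_d -> R) by exact: measurable_indic.
have m4 : measurable_fun setT (fun x : 'rV[R]_d => r * enorm e * (K + rho0 * \1_S x)).
  by do !(apply: measurable_funM => //); apply: measurable_funD => //;
    apply: measurable_funM.
have S1 x : `|\1_S x : R| <= 1 by rewrite indicE; case: (_ \in _); rewrite ?normr0 ?normr1.
have re0 : 0 <= r * enorm e by rewrite mulr_ge0 ?enorm_ge0// ltW.
have b4 x : eball 0 r x -> `|r * enorm e * (K + rho0 * \1_S x)| <= r * enorm e * M.
  move=> _; rewrite normrM (ger0_norm re0) ler_wpM2l//.
  apply: le_trans (ler_normD _ _) _; rewrite normrM !ger0_norm// /M -addrA lerD2l.
  by have := S1 x; rewrite ler_norml => /andP[_]; nra.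
have i4 := integrable_eball r0 m4 b4.
have iS : la.-integrable (eball 0 r) (EFin \o (fun x : 'rV[R]_d => \1_S x)).
  by apply: (integrable_eball r0 mSi (M := 1)) => x _.
apply: (@le_trans _ _ (\int[la]_(x in eball 0 r) (r * enorm e * (K + rho0 * \1_S x)))).
  apply: le_Rintegral => //.
    apply: (integrable_eball r0 (M := r * enorm e * M + rho0 * (r * enorm e))).
      apply: measurableT_comp => //.
      exact: measurable_funB.
    move=> x xr; rewrite normr_id; apply: le_trans (ler_normB _ _) _.
    by rewrite lerD ?b1 ?b2.
  move=> x xr; have -> : dotv x e * rho (x + x0) - rho0 * (dotv x e * psi (dotv x nu)) =
      dotv x e * (rho (x + x0) - rho0 * psi (dotv x nu)) by ring.
  rewrite normrM ler_pM ?normr_dotv_eball//.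
  by have := H (x + x0) (B0x0 _ xr); rewrite addrK.
have m5 : measurable_fun setT (fun x : 'rV[R]_d => rho0 * \1_S x) by apply: measurable_funM.
have i5 : la.-integrable (eball 0 r) (EFin \o (fun x : 'rV[R]_d => rho0 * \1_S x)).
  apply: (integrable_eball r0 m5 (M := rho0)) => x _.
  by rewrite normrM ger0_norm// -[leRHS]mulr1 ler_wpM2l.
have i6 : la.-integrable (eball 0 r) (EFin \o (fun=> K)).
  by apply: (integrable_eball r0 (M := K)) => // x _; rewrite ger0_norm.
have i7 : la.-integrable (eball 0 r) (EFin \o (fun x : 'rV[R]_d => K + rho0 * \1_S x)).
  exact: (integrableD mB i6 i5).
rewrite RintegralZl// ler_wpM2l// RintegralD// RintegralZl// Rintegral_cst//.
rewrite (_ : fine _ = r ^+ d * omega_ball R d); last first.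
  exact: (congr1 fine (lebesgue_rV_eball 0 r0)).
rewrite lerD2l ler_wpM2l//.
rewrite /Rintegral integral_indic// setIC -lee_fin fineK.
  exact: lebesgue_rV_ball_slab.
rewrite ge0_fin_numE//; apply: le_lt_trans (lebesgue_rV_ball_slab delta nu1 r0 c0) _.
exact: ltry.
Qed.

End mean_bias.

(** * Independent variables *)

Section monotone_class.
Context {R : realType} {d2} {U : measurableType d2}.

Import HBNNSimple.

Section expansion.
Context {d1} {T : measurableType d1} (mu : {measure set T -> \bar R}).
Variables (Y : T -> U) (w : T -> R).
Hypotheses (mY : measurable_fun setT Y) (mw : measurable_fun setT w).
Hypothesis w0 : forall t, 0 <= w t.

Lemma integral_nnsfun_comp (h : {nnsfun U >-> R}) :
  (\int[mu]_t (h (Y t) * w t)%:E = \sum_(y \in range h)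
     (y%:E * \int[mu]_t (\1_(h @^-1` [set y]) (Y t) * w t)%:E))%E.
Proof.
have mind y : measurable_fun setT (fun t => \1_(h @^-1` [set y]) (Y t) * w t : R).
  apply: measurable_funM => //; apply: (measurableT_comp _ mY).
  exact: measurable_indic.
have hy y : y \in range h -> 0 <= y by rewrite inE => -[u _ <-].
transitivity (\int[mu]_t (\sum_(y \in range h)
    (y%:E * (\1_(h @^-1` [set y]) (Y t) * w t)%:E)))%E.
  apply: eq_integral => t _; rewrite fimfunE EFinM -fsumEFin// ge0_mule_fsuml.
    by apply: eq_fsbigr => y _; rewrite -!EFinM mulrA.
  by move=> y; exact: nnfun_muleindic_ge0.
rewrite ge0_integral_fsum//; last 2 first.
- by move=> y; apply/measurable_EFinP; apply: measurable_funM.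
- move=> y t _; have [yr|yr] := boolP (y \in range h).
    by apply: mule_ge0; rewrite lee_fin ?mulr_ge0// hy.
  rewrite (_ : \1_ _ _ = 0 :> R) ?mul0r ?mule0//.
  rewrite indicE (_ : _ \in _ = false)//; apply/negP; rewrite inE/= => hYt.
  by move/negP: yr; apply; rewrite inE; exists (Y t).
apply: eq_fsbigr => y yr; rewrite ge0_integralZl//.
- exact/measurable_EFinP.
- by move=> t _; rewrite lee_fin mulr_ge0.
- by rewrite lee_fin hy.
Qed.

Lemma integral_comp_lim (f : U -> R) (mf : measurable_fun setT (EFin \o f)) :
  (forall u, 0 <= f u) ->
  (\int[mu]_t (f (Y t) * w t)%:E =
   limn (fun n => \int[mu]_t (nnsfun_approx measurableT mf n (Y t) * w t)%:E))%E.
Proof.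
move=> f0; pose h := nnsfun_approx measurableT mf.
rewrite -monotone_convergence//.
- apply: eq_integral => t _; apply/esym/cvg_lim => //.
  under eq_fun do rewrite EFinM.
  rewrite EFinM; apply: cvgeZr => //.
  by apply: cvg_nnsfun_approx => // u _; rewrite lee_fin.
- move=> n; apply/measurable_EFinP; apply: measurable_funM => //.
  by apply: measurableT_comp.
- by move=> n t _; rewrite lee_fin mulr_ge0.
- move=> t _ a b ab; rewrite lee_fin ler_wpM2r//.
  by apply/lefP; exact: nd_nnsfun_approx.
Qed.

End expansion.

(** Nonnegative functions are increasing limits of combinations of indicators. This
    serves both to integrate against a density and to pass from independent events
    to independent variables. *)
Lemma eq_integral_of_indic d1 (T1 : measurableType d1)
    (mu1 : {measure set T1 -> \bar R}) (Y1 : T1 -> U) (w1 : T1 -> R)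
    d1' (T2 : measurableType d1')
    (mu2 : {measure set T2 -> \bar R}) (Y2 : T2 -> U) (w2 : T2 -> R) :
  measurable_fun setT Y1 -> measurable_fun setT w1 -> (forall t, 0 <= w1 t) ->
  measurable_fun setT Y2 -> measurable_fun setT w2 -> (forall t, 0 <= w2 t) ->
  (forall A, measurable A -> \int[mu1]_t (\1_A (Y1 t) * w1 t)%:E =
                             \int[mu2]_t (\1_A (Y2 t) * w2 t)%:E)%E ->
  forall f : U -> R, measurable_fun setT f -> (forall u, 0 <= f u) ->
  (\int[mu1]_t (f (Y1 t) * w1 t)%:E = \int[mu2]_t (f (Y2 t) * w2 t)%:E)%E.
Proof.
move=> mY1 mw1 w10 mY2 mw2 w20 E f mf f0.
have mf' : measurable_fun setT (EFin \o f) by exact/measurable_EFinP.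
rewrite (integral_comp_lim mu1 mY1 mw1 w10 mf' f0).
rewrite (integral_comp_lim mu2 mY2 mw2 w20 mf' f0).
congr (limn _); apply/funext => n; rewrite !integral_nnsfun_comp//.
by apply: eq_fsbigr => y _; rewrite E.
Qed.

End monotone_class.

Lemma integrable_bounded {R : realType} {dT} {T : measurableType dT}
    (P : probability T R) (g : T -> R) (M : R) : measurable_fun setT g ->
  (forall t, `|g t| <= M) -> P.-integrable setT (EFin \o g).
Proof.
move=> mg gM; apply: measurable_bounded_integrable => //.
- by apply: le_lt_trans (probability_le1 P measurableT) _; rewrite ltry.
- exists M; split => [|N MN x _]; first exact: num_real.
  by apply: le_trans (gM x) _; exact: ltW.
Qed.

Section independence.
Context {R : realType} {dT dU} {T : measurableType dT} {U : measurableType dU}.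
Variables (P : probability T R) (n : nat) (X : 'I_n -> T -> U).
Hypothesis mX : forall i, measurable_fun setT (X i).
Hypothesis indepX : forall (J : {set 'I_n}) (A : 'I_n -> set U),
  (forall i, measurable (A i)) ->
  P (\bigcap_(i in [set` J]) (X i @^-1` A i)) = (\prod_(i in J) P (X i @^-1` A i))%E.

(** For indicators this is the independence of events. The other functions are
    brought in one index at a time, by [eq_integral_of_indic]: [s] lists the indices
    at which [g] need not be an indicator. *)
Lemma expectation_prod_indep (g : 'I_n -> U -> R) (M : R) :
  (forall i, measurable_fun setT (g i)) -> (forall i u, 0 <= g i u <= M) ->
  (\int[P]_t (\prod_i g i (X i t))%:E =
   (\prod_i fine (\int[P]_t (g i (X i t))%:E))%:E)%E.
Proof.
suff H (s : seq 'I_n) : forall g : 'I_n -> U -> R,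
    (forall i, measurable_fun setT (g i)) ->
    (forall i, exists M, forall u, 0 <= g i u <= M) ->
    (forall i, i \notin s -> exists2 A, measurable A & g i = \1_A) ->
  (\int[P]_t (\prod_i g i (X i t))%:E =
   (\prod_i fine (\int[P]_t (g i (X i t))%:E))%:E)%E.
  move=> mg gM; apply: (H (enum 'I_n)) => //; first by move=> i; exists M.
  by move=> i; rewrite mem_enum.
move=> {g M}; elim: s => [|j s IH] g mg gM gs.
  have [A AE] : exists A, forall i, measurable (A i) /\ g i = \1_(A i).
    have /(_ _)/cid2 := fun i => gs i isT.
    by move=> F; exists (fun i => projT1 (F i)) => i; case: (F i).
  have mA i : measurable (A i) by have [] := AE i.
  have gE i : g i = \1_(A i) by have [] := AE i.
  have mXA i : measurable (X i @^-1` A i).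
    by rewrite -[X in measurable X]setTI; exact: mX.
  transitivity (\int[P]_t (\1_(\bigcap_(i in [set` [set: 'I_n]%SET]) (X i @^-1` A i)) t)%:E)%E.
    apply: eq_integral => t _; congr _%:E; rewrite indicE.
    have [h|h] := boolP (t \in _).
      rewrite big1// => i _; rewrite gE indicE mem_set//.
      by move: h; rewrite inE => /(_ i); apply; rewrite /= inE.
    have [i tA] : exists i, ~ A i (X i t).
      apply/existsNP => tA; move/negP: h; apply; rewrite inE => i _; exact: tA.
    by rewrite (bigD1 i)//= gE indicE memNset// mul0r.
  rewrite integral_indic//; last first.
    by apply: fin_bigcap_measurable => // i _.
  rewrite setIT -prodEFin.
  transitivity (\prod_(i in [set: 'I_n]%SET) P (X i @^-1` A i))%E; first exact: indepX.
  apply: eq_big => i; first by rewrite inE.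
  move=> _; rewrite (_ : (\int[P]_t _)%E = P (X i @^-1` A i)).
    by rewrite fineK// fin_num_measure.
  rewrite -(setIT (X i @^-1` A i)) -integral_indic//; apply: eq_integral => t _.
  by rewrite gE !indicE; congr (nat_of_bool _)%:R%:E; apply/idP/idP; rewrite !inE.
pose W t : R := \prod_(i | i != j) g i (X i t).
pose C : R := \prod_(i | i != j) fine (\int[P]_t (g i (X i t))%:E)%E.
have g0 i u : 0 <= g i u by have [M /(_ u)/andP[]] := gM i.
have mgX i : measurable_fun setT (fun t => g i (X i t)).
  exact: (measurableT_comp (mg i) (mX i)).
have mW : measurable_fun setT W.
  rewrite (_ : W = fun t => \prod_(i <- [seq i <- index_enum 'I_n | i != j]) g i (X i t)).
    by apply: measurable_prod => i _; exact: mgX.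
  by apply/funext => t; rewrite big_filter.
have W0 t : 0 <= W t by apply: prodr_ge0.
have C0 : 0 <= C.
  by apply: prodr_ge0 => i _; rewrite fine_ge0// integral_ge0// => t _; rewrite lee_fin.
have fin_int i : (\int[P]_t (g i (X i t))%:E \is a fin_num)%E.
  have [M gMi] := gM i; apply: integrable_fin_num => //.
  apply: (@integrable_bounded _ _ _ P _ M) => // t.
  by rewrite ger0_norm//; have /andP[] := gMi (X i t).
transitivity (\int[P]_t (g j (X j t) * W t)%:E)%E.
  by apply: eq_integral => t _; rewrite (bigD1 j).
transitivity (\int[P]_t (g j (X j t) * C)%:E)%E; last first.
  under eq_integral do rewrite EFinM.
  rewrite ge0_integralZr//; last 2 first.
  - exact/measurable_EFinP.
  - by move=> t _; rewrite lee_fin.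
  by rewrite [in RHS](bigD1 j)//= -/C EFinM (fineK (fin_int j)).
apply: (@eq_integral_of_indic _ _ _ _ _ P (X j) W _ _ P (X j) (fun=> C)) => // A mA.
pose g' i := if i == j then \1_A : U -> R else g i.
have := IH g'; rewrite /g' => {}IH.
transitivity (\int[P]_t (\prod_i g' i (X i t))%:E)%E.
  apply: eq_integral => t _; rewrite (bigD1 j)//= /g' eqxx; congr (_ * _)%:E.
  by apply: eq_bigr => i /negbTE ->.
rewrite IH.
- rewrite (bigD1 j)//= eqxx EFinM fineK; last first.
    apply: integrable_fin_num => //; apply: (@integrable_bounded _ _ _ P _ 1).
      by apply: (measurableT_comp _ (mX j)); exact: measurable_indic.
    by move=> t; rewrite indicE; case: (_ \in _); rewrite ?normr0 ?normr1.
  under [RHS]eq_integral do rewrite EFinM.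
  rewrite ge0_integralZr//; last first.
    apply/measurable_EFinP; apply: (measurableT_comp _ (mX j)).
    exact: measurable_indic.
  by congr (_ * _%:E)%E; apply: eq_bigr => i /negbTE ->.
- by move=> i; case: eqP => // _; exact: measurable_indic.
- move=> i; case: eqP => // _; exists 1 => u.
  by rewrite indicE; case: (_ \in _); rewrite ?ler01 ?lexx.
- move=> i si; case: eqP => [_|/eqP ij]; first by exists A.
  by apply: gs; rewrite inE negb_or ij.
Qed.

End independence.

(** * Exponential tail bound *)

Section tail_bound.
Context {R : realType}.

(** From [expR (- x) = expR (- x / 2) ^+ 2 >= (1 - x / 2) ^+ 2]. *)
Lemma expR_le_quadratic (x : R) : x <= 1 -> expR x <= 1 + x + 2 * x ^+ 2.
Proof.
move=> x1.
have h : (1 - x / 2) ^+ 2 <= expR (- x).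
  rewrite (_ : - x = 2%:R * (- x / 2)); last by field.
  rewrite expRM_natl lerXn2r ?nnegrE ?expR_ge0//; first by lra.
  by have := expR_ge1Dx (- x / 2); lra.
have q0 : 0 < 1 + x + 2 * x ^+ 2.
  have := sqr_ge0 (x + 4^-1); nra.
rewrite -[x in expR x]opprK expRN -[leRHS]invrK lef_pV2 ?posrE ?invr_gt0 ?expR_gt0//.
apply: le_trans h; rewrite -[leLHS]mul1r ler_pdivrMr//.
have : 0 <= x ^+ 2 * ((1 - x) * (5 / 4 - x / 2)).
  by rewrite mulr_ge0 ?sqr_ge0// mulr_ge0; lra.
by move=> h; rewrite -subr_ge0 (le_trans h)// le_eqVlt; apply/orP; left; apply/eqP; field.
Qed.

Context {dT dU} {T : measurableType dT} {U : measurableType dU}.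
Variables (P : probability T R) (n : nat) (X : 'I_n -> T -> U).
Hypothesis mX : forall i, measurable_fun setT (X i).
Hypothesis indepX : forall (J : {set 'I_n}) (A : 'I_n -> set U),
  (forall i, measurable (A i)) ->
  P (\bigcap_(i in [set` J]) (X i @^-1` A i)) = (\prod_(i in J) P (X i @^-1` A i))%E.

(** The variable is not centered: the second moment, which exceeds the variance,
    suffices, and the mean comes back through [1 + x <= expR x]. *)
Lemma expectation_expR_le (Z : T -> R) (M s m V : R) :
  measurable_fun setT Z -> (forall t, `|Z t| <= M) -> 0 <= s -> s * M <= 1 ->
  \int[P]_t Z t = m -> \int[P]_t (Z t ^+ 2) <= V ->
  fine (\int[P]_t (expR (s * Z t))%:E)%E <= expR (s * m + 2 * s ^+ 2 * V).
Proof.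
move=> mZ ZM s0 sM Zm ZV.
have M0 : 0 <= M := le_trans (normr_ge0 _) (ZM point).
have mZ2 : measurable_fun setT (fun t => Z t ^+ 2) by exact: measurable_funX.
have iZ := integrable_bounded P mZ ZM.
have bZ2 t : `|Z t ^+ 2| <= M ^+ 2 by rewrite normrX lerXn2r ?nnegrE.
have iZ2 := integrable_bounded P mZ2 bZ2.
have sZ t : s * Z t <= 1.
  by apply: le_trans sM; rewrite ler_wpM2l// (le_trans (ler_norm _)).
have i1 : P.-integrable setT (EFin \o (fun=> 1 : R)).
  by apply: (@integrable_bounded _ _ _ P _ 1) => // t; rewrite normr1.
have isZ : P.-integrable setT (EFin \o (fun t => s * Z t)).
  by apply: (@integrable_bounded _ _ _ P _ (s * M)) => [|t];
    [exact: measurable_funM|rewrite normrM ger0_norm// ler_wpM2l].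
have isZ2 : P.-integrable setT (EFin \o (fun t => 2 * s ^+ 2 * Z t ^+ 2)).
  apply: (@integrable_bounded _ _ _ P _ (2 * s ^+ 2 * M ^+ 2)) => [|t].
    exact: measurable_funM.
  by rewrite normrM ger0_norm ?ler_wpM2l// mulr_ge0// sqr_ge0.
have i1Z : P.-integrable setT (EFin \o (fun t => 1 + s * Z t)).
  exact: (integrableD measurableT i1 isZ).
have iq : P.-integrable setT (EFin \o (fun t => 1 + s * Z t + 2 * s ^+ 2 * Z t ^+ 2)).
  exact: (integrableD measurableT i1Z isZ2).
have me : measurable_fun setT (fun t => expR (s * Z t)).
  by apply: measurableT_comp => //; exact: measurable_funM.
apply: (@le_trans _ _ (\int[P]_t (1 + s * Z t + 2 * s ^+ 2 * Z t ^+ 2))).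
  apply: le_Rintegral => //.
    apply: (@integrable_bounded _ _ _ P _ (expR 1)) => // t.
    by rewrite ger0_norm ?expR_ge0// ler_expR.
  move=> t _; have := expR_le_quadratic (sZ t); rewrite exprMn; lra.
rewrite RintegralD// RintegralD// RintegralZl// RintegralZl// Rintegral_cst//.
rewrite (_ : fine _ = 1); last exact: (congr1 fine (probability_setT P)).
rewrite Zm mulr1 -addrA; apply: le_trans (expR_ge1Dx _); rewrite lerD2l lerD2l.
by rewrite ler_wpM2l// mulr_ge0// sqr_ge0.
Qed.

(** Markov's inequality for the exponential of [s] times the sum, at the minimiser
    [s = t / (4 * V)] of [- s * t + 2 * s ^+ 2 * V]. The bound on [t * M] says that
    [s * M <= 1]. *)
Lemma sum_tail_bound (phi : U -> R) (M m V t : R) :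
  measurable_fun setT phi -> (forall u, `|phi u| <= M) ->
  (forall i, \int[P]_w phi (X i w) = m) ->
  (forall i, \int[P]_w (phi (X i w) ^+ 2) <= V) ->
  0 < V -> 0 < t -> t * M <= 4 * V ->
  (P [set w | n%:R * (m + t) <= \sum_i phi (X i w)]%R <=
   (expR (- (n%:R * (t ^+ 2 / (8 * V)))))%:E)%E.
Proof.
move=> mphi phiM phim phiV V0 t0 tM.
pose s := t / (4 * V).
have s0 : 0 < s by rewrite divr_gt0// mulr_gt0.
have sM : s * M <= 1 by rewrite /s mulrAC ler_pdivrMr ?mulr_gt0// mul1r.
have mphiX i : measurable_fun setT (fun w => phi (X i w)).
  exact: (measurableT_comp mphi (mX i)).
pose g (i : 'I_n) u := expR (s * phi u).
have mg i : measurable_fun setT (g i).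
  by apply: measurableT_comp => //; exact: measurable_funM.
have gM i u : 0 <= g i u <= expR (s * M).
  rewrite expR_ge0 /g ler_expR ler_wpM2l ?(ltW s0)//.
  exact: le_trans (ler_norm _) (phiM u).
have prodE := expectation_prod_indep mX indepX mg gM.
pose S w := \sum_i phi (X i w).
have mS : measurable_fun setT S by exact: measurable_sum.
set E := [set w | _]%R.
have mE : measurable E.
  rewrite (_ : E = S @^-1` `[n%:R * (m + t), +oo[); last first.
    by apply/seteqP; split => w; rewrite /E /S /= in_itv/= andbT.
  by rewrite -[X in measurable X]setTI; exact: mS.
pose a := s * (n%:R * (m + t)).
have step1 : (P E <= \int[P]_w ((expR (- a))%:E * (\prod_i g i (X i w))%:E))%E.
  rewrite -[X in P X]setIT -integral_indic//; apply: ge0_le_integral => //.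
  - by apply/measurable_EFinP; exact: measurable_indic.
  - apply: emeasurable_funM => //; apply/measurable_EFinP.
    by apply: measurable_prod => i _; exact: (measurableT_comp (mg i) (mX i)).
  - move=> w _; rewrite -EFinM lee_fin indicE /g.
    have [|_] := boolP (w \in E); last first.
      by rewrite mulr_ge0 ?expR_ge0// prodr_ge0// => i _; exact: expR_ge0.
    rewrite inE /E/= => Ew.
    rewrite -expR_sum -expRD -mulr_sumr -[leLHS]expR0 ler_expR addrC subr_ge0.
    by rewrite /a ler_wpM2l// ltW.
rewrite ge0_integralZl// in step1; last 2 first.
- apply/measurable_EFinP.
  by apply: measurable_prod => i _; exact: (measurableT_comp (mg i) (mX i)).
- by move=> w _; rewrite lee_fin prodr_ge0// => i _; exact: expR_ge0.
apply: (le_trans step1); rewrite prodE -EFinM lee_fin.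
apply: (@le_trans _ _ (expR (- a) * \prod_(i < n) expR (s * m + 2 * s ^+ 2 * V))).
  rewrite ler_wpM2l ?expR_ge0//; apply: ler_prod => i _; apply/andP; split.
    by rewrite fine_ge0// integral_ge0// => w _; rewrite lee_fin expR_ge0.
  apply: (@expectation_expR_le (fun w => phi (X i w)) M) => //; exact: ltW.
rewrite prodr_const card_ord -expRM_natl -expRD ler_expR /a /s.
by rewrite le_eqVlt; apply/orP; left; apply/eqP; field; rewrite gt_eqF.
Qed.

End tail_bound.

(** * The sample and elementary estimates *)

Section iid_sample.
Context {R : realType} {d : nat} {dT} {T : measurableType dT}.
Variables (P : probability T R) (n : nat) (rho : 'rV[R]_d -> R).
Variable X : 'I_n -> {RV P >-> 'rV[R]_d}.
Hypotheses (hrho : probability_density rho) (hX : iid_sample rho X).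
Local Notation la := (lebesgue_rV (R := R) d).

Let mrho : measurable_fun setT rho. Proof. by have [] := hrho. Qed.

Let rho_ge0 x : 0 <= rho x. Proof. by have [] := hrho. Qed.

Let mX i : measurable_fun setT (X i). Proof. exact: measurable_funPT. Qed.

Lemma iid_integral i (phi : 'rV[R]_d -> R) :
  measurable_fun setT phi -> (forall x, 0 <= phi x) ->
  (\int[P]_t (phi (X i t))%:E = \int[la]_x (phi x * rho x)%:E)%E.
Proof.
move=> mphi phi0.
under eq_integral do rewrite -[phi _]mulr1.
apply: (@eq_integral_of_indic _ _ _ _ _ P (X i) (fun=> 1) _ _ la id rho) => // A mA.
have := hX.1 i A mA; rewrite /distribution /pushforward => PA.
transitivity (P (X i @^-1` A)).
  have mXA : measurable (X i @^-1` A) by rewrite -[X in measurable X]setTI; exact: mX.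
  rewrite -[X in P X]setIT -integral_indic//; apply: eq_integral => t _.
  by rewrite mulr1 !indicE; congr (nat_of_bool _)%:R%:E; apply/idP/idP; rewrite !inE.
rewrite PA; transitivity (\int[la]_x ((fun x => (rho x)%:E) \_ A) x)%E.
  exact: integral_mkcond.
apply: eq_integral => x _.
by rewrite patchE indicE; case: ifPn => _; rewrite ?mul1r ?mul0r.
Qed.

Lemma integrable_mul_density (phi : 'rV[R]_d -> R) (M : R) :
  measurable_fun setT phi -> (forall x, `|phi x| <= M) ->
  la.-integrable setT (EFin \o (fun x => phi x * rho x)).
Proof.
move=> mphi phiM; have M0 : 0 <= M := le_trans (normr_ge0 _) (phiM 0).
apply/integrableP; split.
  by apply/measurable_EFinP; exact: measurable_funM.
apply: (@le_lt_trans _ _ (\int[la]_x (M%:E * (rho x)%:E))%E).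
  apply: ge0_le_integral => //.
  - by apply: measurableT_comp => //; apply/measurable_EFinP; exact: measurable_funM.
  - by apply/measurable_EFinP; exact: measurable_funM.
  - by move=> x _; rewrite /= lee_fin normrM (ger0_norm (rho_ge0 x)) ler_wpM2r.
rewrite ge0_integralZl//.
- by have [_ _ ->] := hrho; rewrite mule1 ltry.
- exact/measurable_EFinP.
- by move=> x _; rewrite lee_fin.
Qed.

(** [iid_integral] applies to the nonnegative function [phi + M]. *)
Lemma iid_Rintegral i (phi : 'rV[R]_d -> R) (M : R) :
  measurable_fun setT phi -> (forall x, `|phi x| <= M) ->
  \int[P]_t phi (X i t) = \int[la]_x (phi x * rho x).
Proof.
move=> mphi phiM; have M0 : 0 <= M := le_trans (normr_ge0 _) (phiM 0).
have iP (psi : 'rV[R]_d -> R) (N : R) : measurable_fun setT psi ->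
    (forall x, `|psi x| <= N) -> P.-integrable setT (EFin \o (fun t => psi (X i t))).
  move=> mpsi psiN; apply: (@integrable_bounded _ _ _ P _ N) => //.
  exact: (measurableT_comp mpsi (mX i)).
have : \int[P]_t (phi (X i t) + M) = \int[la]_x ((phi x + M) * rho x).
  rewrite /Rintegral; congr fine; apply: (@iid_integral i (fun x => phi x + M)).
    exact: measurable_funD.
  by move=> x; have := phiM x; rewrite ler_norml => /andP[]; lra.
have mc : measurable_fun setT (fun x : 'rV[R]_d => M : R) by exact: measurable_cst.
have cM (x : 'rV[R]_d) : `|M| <= M by rewrite ger0_norm.
under [RHS]eq_Rintegral do rewrite mulrDl.
rewrite RintegralD//; last 2 first.
- exact: (iP phi M).
- exact: (iP (fun=> M) M).
rewrite RintegralD//; last 2 first.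
- exact: (integrable_mul_density mphi phiM).
- exact: (integrable_mul_density mc cM).
have -> : \int[P]_t M = \int[la]_x (M * rho x).
  rewrite /Rintegral; congr fine.
  by apply: (@iid_integral i (fun=> M)).
by move/addIr.
Qed.

End iid_sample.

Section estimates.
Context {R : realType}.

Lemma bernoulli_ineq (x : R) (k : nat) : 0 <= x <= 1 -> 1 - k%:R * x <= (1 - x) ^+ k.
Proof.
move=> /andP[x0 x1]; elim: k => [|k IH]; first by rewrite mul0r subr0 expr0.
rewrite exprS; have h : (1 - x) * (1 - k%:R * x) <= (1 - x) * (1 - x) ^+ k.
  by rewrite ler_wpM2l// subr_ge0.
apply: le_trans h; rewrite -natr1.
have : 0 <= k%:R * x ^+ 2 by rewrite mulr_ge0// sqr_ge0.
nra.
Qed.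

(** The offset [delta] of the half space costs only a constant factor in the moment,
    uniformly in the dimension [k.+1], because [delta] is at most of order
    [r / Num.sqrt k.+1%:R]. *)
Lemma sqrt_pow_ge (k : nat) (r delta : R) : 0 < r ->
  9 * k.+1%:R * delta ^+ 2 <= 4 * r ^+ 2 ->
  7 / 15 * r ^+ k.+2 <= Num.sqrt (r ^+ 2 - delta ^+ 2) ^+ k.+2.
Proof.
move=> r0 hdelta.
have k1 : (1 : R) <= k.+1%:R by rewrite ler1n.
have k0 : (0 : R) < k.+1%:R by rewrite ltr0n.
pose x : R := 4 / (15 * k.+1%:R).
have xk : x * (15 * k.+1%:R) = 4 by rewrite /x divfK// gt_eqF// mulr_gt0.
have x0 : 0 < x by rewrite /x divr_gt0// mulr_gt0.
have x1 : x <= 4 / 15 by nra.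
have q0 : 0 <= r * (1 - x) by rewrite mulr_ge0; lra.
have h1 : r * (1 - x) <= Num.sqrt (r ^+ 2 - delta ^+ 2).
  rewrite -[leLHS]ger0_norm// -sqrtr_sqr ler_sqrt.
    have : delta ^+ 2 <= 5 / 3 * x * r ^+ 2.
      rewrite -(ler_pM2l (_ : 0 < 9 * k.+1%:R)) ?mulr_gt0//.
      by apply: le_trans hdelta _; have := sqr_ge0 r; nra.
    by have := sqr_ge0 r; nra.
  have : delta ^+ 2 <= r ^+ 2.
    have := sqr_ge0 delta; have := sqr_ge0 r; nra.
  by rewrite subr_ge0.
apply: (@le_trans _ _ ((r * (1 - x)) ^+ k.+2)); last first.
  by rewrite lerXn2r ?nnegrE ?sqrtr_ge0.
rewrite exprMn [leRHS]mulrC ler_wpM2r ?exprn_ge0 ?(ltW r0)//.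
have x01 : 0 <= x <= 1 by apply/andP; split; lra.
apply: (le_trans _ (bernoulli_ineq k.+2 x01)).
by rewrite -natr1; nra.
Qed.

Context {d : nat}.
Implicit Types (a nu : 'rV[R]_d).

(** Dividing by the norm at most doubles the relative error. *)
Lemma normalize_error a nu (m e : R) : enorm nu = 1 -> 0 < m ->
  enorm (a - m *: nu) <= e ->
  enorm ((enorm a)^-1 *: a - nu) <= 2 * e / m.
Proof.
move=> nu1 m0 ae; rewrite ler_pdivlMr//.
have mnu : enorm (m *: nu) = m by rewrite enormZ nu1 mulr1 gtr0_norm.
have h1 := enorm_triangle a (m *: nu) 0.
have h2 := enorm_triangle (m *: nu) a 0.
rewrite !subr0 mnu in h1 h2; rewrite (enormB (m *: nu)) in h1.
have [a0|a0] := eqVneq (enorm a) 0.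
  (* The normalized vector is then 0, at distance 1 from [nu], but [e] is at least [m]. *)
  rewrite (enorm_eq0 a0) scaler0 sub0r enormN nu1 mul1r.
  by move: h1; rewrite a0; lra.
have apos : 0 < enorm a by rewrite lt0r a0 enorm_ge0.
rewrite mulrC -[X in X * _](gtr0_norm m0) -enormZ.
have -> : m *: ((enorm a)^-1 *: a - nu) =
    ((m - enorm a) / enorm a) *: a + (a - m *: nu).
  apply/rowP => i; rewrite !mxE; field; exact: a0.
apply: le_trans (enormD _ _) _; rewrite enormZ normrM normfV (gtr0_norm apos).
rewrite divfK//; have : `|m - enorm a| <= e by rewrite ler_norml; apply/andP; split; lra.
lra.
Qed.

End estimates.

(** * The normal estimator *)

Lemma Rintegral_sum_ord {R : realType} d1 (T : measurableType d1) (mu : {measure set T -> \bar R})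
    (D : set T) (k : nat) (f : 'I_k -> T -> R) : measurable D ->
  (forall i, mu.-integrable D (EFin \o f i)) ->
  \int[mu]_(x in D) (\sum_i f i x) = \sum_i \int[mu]_(x in D) f i x.
Proof.
move=> mD fi; rewrite /Rintegral.
have fin_int i : (\int[mu]_(x in D) (f i x)%:E)%E \is a fin_num.
  exact: (integrable_fin_num mD (fi i)).
transitivity (fine (\sum_i fine (\int[mu]_(x in D) (f i x)%:E))%:E)%E => //.
congr fine; rewrite -sumEFin.
under [RHS]eq_bigr do rewrite fineK//.
rewrite -integral_sum//.
by apply: eq_integral => x _; rewrite sumEFin.
Qed.

Section estimator.
Context {R : realType} {d' : nat}.
Local Notation d := d'.+1.
Local Notation la := (lebesgue_rV (R := R) d).

(** The summands of [vhat], by coordinate. *)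
Definition ball_coord (x0 : 'rV[R]_d) (r : R) (j : 'I_d) (x : 'rV[R]_d) : R :=
  \1_(eball x0 r) x * (x - x0) ord0 j.

Lemma measurable_ball_coord x0 r j : measurable_fun setT (ball_coord x0 r j).
Proof.
apply: measurable_funM; first by apply: measurable_indic; exact: measurable_eball.
exact: (measurableT_comp (measurable_rV_coord j) (measurable_addv (- x0))).
Qed.

Lemma normr_ball_coord x0 r j x : 0 < r -> `|ball_coord x0 r j x| <= r.
Proof.
move=> r0; rewrite /ball_coord indicE.
have [|_] := boolP (x \in eball x0 r); last by rewrite mul0r normr0 ltW.
rewrite inE mul1r /eball/= => /ltW; apply: le_trans; exact: normr_coord_le_enorm.
Qed.

Lemma vhat_coord n (r : R) x0 (x : 'I_n -> 'rV[R]_d) j :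
  vhat r x0 x ord0 j = n%:R^-1 * \sum_i ball_coord x0 r j (x i).
Proof.
by rewrite /vhat mxE summxE; congr (_ * _); apply: eq_bigr => i _; rewrite mxE.
Qed.

Lemma dotv_mean (rho : 'rV[R]_d -> R) x0 (r : R) e : 0 < r ->
  probability_density rho ->
  dotv (\row_j \int[la]_x (ball_coord x0 r j x * rho x)) e =
  \int[la]_(x in eball x0 r) (dotv (x - x0) e * rho x).
Proof.
move=> r0 hrho.
have ibc j : la.-integrable setT (EFin \o (fun x => ball_coord x0 r j x * rho x)).
  apply: (integrable_mul_density hrho (M := r)); first exact: measurable_ball_coord.
  by move=> x; exact: normr_ball_coord.
rewrite /dotv; under eq_bigr do rewrite mxE -RintegralZr//.
rewrite -Rintegral_sum_ord//; last first.
  move=> j; rewrite (_ : _ \o _ = fun x =>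
    ((ball_coord x0 r j x * rho x)%:E * (e ord0 j)%:E)%E)//.
  by apply: integrableZr => //; exact: ibc.
rewrite [RHS]Rintegral_mkcond; apply: eq_Rintegral => x _.
rewrite patchE /dotv; under eq_bigr do rewrite /ball_coord indicE -mulrA -mulrA.
case: ifPn => _; last by rewrite big1// => j _; rewrite mul0r.
by rewrite mulr_suml; apply: eq_bigr => j _; rewrite mul1r; ring.
Qed.

Lemma measurable_nuhat dT (T : measurableType dT) n (r : R) x0
    (X : 'I_n -> T -> 'rV[R]_d) : (forall i, measurable_fun setT (X i)) ->
  measurable_fun setT (fun t => nuhat r x0 (fun i => X i t)).
Proof.
move=> mX.
have mv j : measurable_fun setT (fun t => vhat r x0 (fun i => X i t) ord0 j).
  under eq_fun do rewrite vhat_coord.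
  apply: measurable_funM => //; apply: measurable_sum => i.
  exact: (measurableT_comp (measurable_ball_coord x0 r j) (mX i)).
have mvhat : measurable_fun setT (fun t => vhat r x0 (fun i => X i t)).
  exact: measurable_fun_rVP.
apply: measurable_fun_rVP => j; rewrite /nuhat.
under eq_fun do rewrite mxE -powR_inv1 ?enorm_ge0//.
apply: measurable_funM => //.
apply: (measurableT_comp (measurable_powR _)).
exact: (measurableT_comp measurable_enorm mvhat).
Qed.


Lemma Cy_gt0 : 0 < Cy R d.
Proof. by rewrite divr_gt0 ?omega_ball_gt0// mulr_gt0. Qed.

(** The moment of a half ball of radius 1 is at most the volume of the ball, which
    is [mean_bias] for the zero function. *)
Lemma Cy_le_omega : Cy R d <= 4 * omega_ball R d.
Proof.
pose nu : 'rV[R]_d := delta_mx ord0 ord0.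
have nu1 : enorm nu = 1.
  by rewrite /enorm dotv_delta mxE !eqxx sqrtr1.
(* Any positive offset allowed by [sqrt_pow_ge] would do. *)
pose delta : R := 2 / (3 * d%:R).
have d1 : (1 : R) <= d%:R by rewrite ler1n.
have deltad : delta * (3 * d%:R) = 2 by rewrite /delta divfK// gt_eqF// mulr_gt0.
have delta01 : 0 < delta < 1.
  by apply/andP; split; [rewrite /delta divr_gt0// mulr_gt0|nra].
have delta_small : 9 * d%:R * delta ^+ 2 <= 4 * 1 ^+ 2.
  have -> : 9 * d%:R * delta ^+ 2 = 2 * 3 * delta.
    by rewrite -deltad expr2; ring.
  by rewrite expr1n; nra.
have H x : eball 0 1 x -> `|(0 : R) - 1 * (- delta < dotv (x - 0) nu)%R%:R| <=
    1 + 1 * \1_[set y : 'rV[R]_d | `|dotv y nu + delta| <= 0]%R (x - 0).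
  move=> _; rewrite sub0r normrN !mul1r.
  apply: (@le_trans _ _ 1); last by rewrite lerDl.
  by case: ltP => _; rewrite ?normr1 ?normr0.
have mcst : measurable_fun setT (fun _ : 'rV[R]_d => 0 : R) by exact: measurable_cst.
have := @mean_bias _ _ (fun=> 0) 0 nu nu 1 delta 0 1 1 nu1 delta01
  (lexx _) ler01 ler01 mcst H.
have := sqrt_pow_ge ltr01 delta_small.
move: (Num.sqrt _ ^+ d'.+2) => h hge; rewrite expr1n mulr1 in hge.
have nunu : dotv nu nu = 1 by rewrite -sqr_enorm nu1 expr1n.
under eq_Rintegral do rewrite mulr0.
rewrite Rintegral_cst; last exact: measurable_eball.
rewrite nu1 nunu !expr1n !(mul0r, mulr0, mul1r, mulr1, addr0) sub0r normrN.
move=> /(le_trans (ler_norm _)).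
have -> : omega_ball R d' * (h / d'.+2%:R) = 2 * Cy R d * h.
  by rewrite /Cy; field; rewrite gt_eqF// ltr0n.
have W0 : 0 < omega_ball R d := omega_ball_gt0.
by have := ler_wpM2l (ltW Cy_gt0) hge; lra.
Qed.

(** The mean of [vhat] is the moment of a half ball, up to the errors due to the
    curvature of the frontier and to the variation of the density. *)
Lemma mean_estimate (Omega : set 'rV[R]_d) (rho : 'rV[R]_d -> R)
    (rho_min L rad r : R) x0 nu (delta := dist_to x0 (frontier Omega)) :
  open Omega -> 0 < rad ->
  (rad%:E <= reach Omega)%E -> (rad%:E <= reach (~` Omega))%E ->
  probability_density rho -> 0 < rho_min -> rho_min <= rho x0 -> 0 <= L ->
  (forall x, ~ Omega x -> rho x = 0) ->
  (forall x, Omega x -> `|rho x - rho x0| <= L * enorm (x - x0)) ->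
  Omega x0 -> normal_at Omega x0 nu -> 4 * r <= rad -> 0 < delta < r ->
  enorm (\row_j \int[la]_x (ball_coord x0 r j x * rho x) -
    (rho x0 * (omega_ball R d' *
      (Num.sqrt (r ^+ 2 - delta ^+ 2) ^+ d'.+2 / d'.+2%:R))) *: nu) <=
  rho x0 * (Cx d L rad rho_min * r ^+ d'.+3 / rad).
Proof.
move=> oO rad0 rO rC hrho rmin0 rmin L0 hout hlip Ox0 hnu rrad deltar.
have /andP[delta0 dr] := deltar; have r0 := lt_trans delta0 dr.
have [mrho rho_ge0 _] := hrho.
have [xs _ [nu1 _]] := hnu.
set rho0 := rho x0 in rmin hlip *; have rho00 : 0 < rho0 by lra.
set v := \row_j _; set m := omega_ball R d' * _.
pose W := omega_ball R d; pose W' := omega_ball R d'.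
have W0 : 0 < W := omega_ball_gt0.
have W'0 : 0 < W' := omega_ball_gt0.
set E0 := _ * _ / rad.
pose e := v - (rho0 * m) *: nu.
pose c := r ^+ 2 / rad.
have c0 : 0 <= c by rewrite divr_ge0 ?sqr_ge0// ltW.
have K0 : 0 <= L * r by rewrite mulr_ge0// ltW.
have near_half x : eball x0 r x ->
    `|rho x - rho0 * (- delta < dotv (x - x0) nu)%R%:R| <=
    L * r + rho0 * \1_[set y : 'rV[R]_d | `|dotv y nu + delta| <= c]%R (x - x0).
  move=> xr; have [inO outO] := domain_between_slabs oO rO rC Ox0 hnu r0 rrad (ltW dr) xr.
  rewrite -/delta -/c in inO outO.
  have lipx : Omega x -> `|rho x - rho0| <= L * r.
    by move=> Ox; rewrite (le_trans (hlip _ Ox))// ler_wpM2l// ltW.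
  have rhox0 := rho_ge0 x.
  clear -inO outO lipx rhox0 hout K0 rho00 c0.
  set z := dotv (x - x0) nu in inO outO *.
  have [zc|zc] := leP `|z + delta| c.
    rewrite indicE mem_set//= mulr1.
    have [/lipx|/hout ->] := pselect (Omega x).
      rewrite ler_norml => /andP[l1 l2].
      by case: (ltP (- delta) z) => _; rewrite ?mulr1 ?mulr0 ler_norml;
        apply/andP; split; lra.
    by case: (ltP (- delta) z) => _; rewrite ?mulr1 ?mulr0 ler_norml;
      apply/andP; split; lra.
  rewrite indicE memNset/= ?mulr0 ?addr0; last by apply/negP; rewrite -ltNge.
  move: zc; rewrite ltr_normr => /orP[zc|zc].
    have Ox : Omega x by apply: inO.
    case: (ltP (- delta) z) => dz; last by exfalso; lra.
    by rewrite mulr1 lipx.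
  have Ox : ~ Omega x by apply: outO; lra.
  rewrite hout//; case: (ltP (- delta) z) => dz; first by exfalso; lra.
  by rewrite mulr0 subr0 normr0.
have := mean_bias e nu1 deltar c0 K0 (ltW rho00) mrho near_half.
rewrite -/W -/W' -/m -(dotv_mean _ _ r0 hrho) -/v.
have -> : dotv v e - rho0 * m * dotv e nu = enorm e ^+ 2.
  rewrite sqr_enorm; have -> : dotv e e = dotv v e - dotv ((rho0 * m) *: nu) e.
    by rewrite -dotvNl -dotvDl.
  by rewrite dotvZl (dotvC nu).
rewrite ger0_norm ?sqr_ge0// => bias2.
have bnd : r * (L * r * (r ^+ d * W) + rho0 * (2 * c * (r ^+ d' * W'))) <= rho0 * E0.
  have -> : r * (L * r * (r ^+ d * W) + rho0 * (2 * c * (r ^+ d' * W'))) =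
      (L * W + rho0 * 2 * W' / rad) * r ^+ d'.+3.
    by rewrite /c !exprS; field; rewrite gt_eqF.
  have -> : rho0 * E0 =
      (rho0 / rho_min * (L * W) + rho0 * 2 * W' / rad) * r ^+ d'.+3.
    by rewrite /E0 /Cx /= -/W -/W'; field; rewrite !gt_eqF.
  rewrite ler_wpM2r ?exprn_ge0 ?(ltW r0)// lerD2r ler_peMl//.
    by rewrite mulr_ge0// ltW.
  by rewrite ler_pdivlMr// mul1r.
have E00 : 0 <= rho0 * E0.
  apply: le_trans bnd; rewrite mulr_ge0 ?(ltW r0)//.
  by rewrite addr_ge0// !mulr_ge0 ?exprn_ge0 ?(ltW r0) ?(ltW W0) ?(ltW W'0)
    ?(ltW rho00) ?invr_ge0 ?(ltW rad0).
have [->//|e0] := eqVneq (enorm e) 0.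
have epos : 0 < enorm e by rewrite lt0r e0 enorm_ge0.
rewrite -(ler_pM2r epos) -expr2; apply: (le_trans bias2).
by rewrite [leLHS]mulrAC ler_wpM2r ?enorm_ge0.
Qed.

Section concentration.
Context {dT} {T : measurableType dT}.
Variables (P : probability T R) (n : nat) (rho : 'rV[R]_d -> R).
Variable X : 'I_n -> {RV P >-> 'rV[R]_d}.
Hypotheses (hrho : probability_density rho) (hX : iid_sample rho X).
Variables (rho_max r : R) (x0 : 'rV[R]_d).
Hypotheses (hmax : forall x, rho x <= rho_max) (rmax0 : 0 < rho_max) (r0 : 0 < r).

Let v : 'rV[R]_d := \row_j \int[la]_x (ball_coord x0 r j x * rho x).
Let V := rho_max * omega_ball R d * r ^+ d'.+3.

Let mX i : measurable_fun setT (X i). Proof. exact: measurable_funPT. Qed.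

Let E (tau s : R) j := [set w | n%:R * (s * v ord0 j + tau) <=
  \sum_i s * ball_coord x0 r j (X i w)].

Let mbc (s : R) j : measurable_fun setT (fun x => s * ball_coord x0 r j x).
Proof. by apply: measurable_funM => //; exact: measurable_ball_coord. Qed.

Let mE tau s j : measurable (E tau s j).
Proof.
rewrite (_ : E tau s j = (fun w => \sum_i s * ball_coord x0 r j (X i w)) @^-1`
    `[n%:R * (s * v ord0 j + tau), +oo[); last first.
  by apply/seteqP; split => w; rewrite /E/= in_itv/= andbT.
rewrite -[X in measurable X]setTI; apply: measurable_sum => // i.
exact: (measurableT_comp (mbc s j) (mX i)).
Qed.

Let second_moment j :
  \int[la]_x (ball_coord x0 r j x ^+ 2 * rho x) <= V.
Proof.
have [mrho rho_ge0 _] := hrho.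
have -> : \int[la]_x (ball_coord x0 r j x ^+ 2 * rho x) =
    \int[la]_(x in eball x0 r) (((x - x0) ord0 j) ^+ 2 * rho x).
  rewrite [RHS]Rintegral_mkcond; apply: eq_Rintegral => x _.
  rewrite /ball_coord patchE indicE.
  by case: ifPn => _; rewrite ?mul1r// mul0r expr0n/= mul0r.
have sqr_bound x : eball x0 r x ->
    0 <= ((x - x0) ord0 j) ^+ 2 * rho x <= r ^+ 2 * rho_max.
  move=> xr; rewrite mulr_ge0 ?sqr_ge0//= ler_pM ?sqr_ge0//.
  rewrite -real_normK ?num_real// lerXn2r ?nnegrE ?(ltW r0)//.
  by apply: le_trans (normr_coord_le_enorm _ _) _; exact: ltW.
have mB : measurable (eball x0 r : set 'rV[R]_d) by exact: measurable_eball.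
apply: (@le_trans _ _ (\int[la]_(x in eball x0 r) (r ^+ 2 * rho_max))).
  apply: le_Rintegral => //.
  - apply: (integrable_eball r0 (M := r ^+ 2 * rho_max)).
      apply: measurable_funM => //; apply: measurable_funX.
      exact: (measurableT_comp (measurable_rV_coord j) (measurable_addv (- x0))).
    by move=> x /sqr_bound/andP[b0 b1]; rewrite ger0_norm.
  - apply: (integrable_eball r0 (M := r ^+ 2 * rho_max)) => // x _.
    by rewrite ger0_norm// mulr_ge0 ?sqr_ge0// ltW.
  - by move=> x /sqr_bound/andP[].
rewrite Rintegral_cst//.
rewrite (_ : fine _ = r ^+ d * omega_ball R d); last first.
  exact: (congr1 fine (lebesgue_rV_eball x0 r0)).
by rewrite /V !exprS le_eqVlt; apply/orP; left; apply/eqP; ring.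
Qed.

Let coord_tail tau s j : `|s| = 1 -> 0 < tau -> tau * r <= 4 * V ->
  (P (E tau s j) <= (expR (- (n%:R * (tau ^+ 2 / (8 * V)))))%:E)%E.
Proof.
move=> s1 tau0 tauV; have s2 : s ^+ 2 = 1 by rewrite -real_normK ?num_real// s1 expr1n.
have V0 : 0 < V.
  apply: mulr_gt0; last exact: exprn_gt0.
  by rewrite mulr_gt0// omega_ball_gt0.
have bcM x : `|s * ball_coord x0 r j x| <= r.
  by rewrite normrM s1 mul1r normr_ball_coord.
apply: (@sum_tail_bound _ _ _ _ _ P n X mX hX.2 (fun x => s * ball_coord x0 r j x) r
  (s * v ord0 j) V tau) => // i.
  rewrite (iid_Rintegral hrho hX i (mbc s j) bcM) /v mxE.
  rewrite -RintegralZl//; last first.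
    apply: (integrable_mul_density hrho (M := r)); first exact: measurable_ball_coord.
    by move=> x; exact: normr_ball_coord.
  by apply: eq_Rintegral => x _; rewrite mulrA.
have bcM2 x : `|(s * ball_coord x0 r j x) ^+ 2| <= r ^+ 2.
  by rewrite normrX lerXn2r ?nnegrE ?(ltW r0).
rewrite (@iid_Rintegral _ _ _ _ _ _ _ _ hrho hX i
  (fun x => (s * ball_coord x0 r j x) ^+ 2) (r ^+ 2))//; last first.
  exact: measurable_funX.
by under eq_Rintegral do rewrite exprMn s2 mul1r; exact: second_moment.
Qed.

(** A union bound over the [2 * d] one-sided deviations of the coordinates. *)
Lemma vhat_concentration (tau : R) (B : set T) :
  (0 < n)%N -> 0 < tau -> tau * r <= 4 * V -> measurable B ->
  (forall w, B w -> d%:R * tau < enorm (vhat r x0 (fun i => X i w) - v)) ->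
  (P B <= (2 * d%:R * expR (- (n%:R * (tau ^+ 2 / (8 * V)))))%:E)%E.
Proof.
move=> n0 tau0 tauV mB Bdev; set q := expR _.
pose U s := \big[setU/set0]_(k < d) E tau s (inord k).
have mU s : measurable (U s) by apply: bigsetU_measurable => k _; exact: mE.
have PU s : `|s| = 1 -> (P (U s) <= (d%:R * q)%:E)%E.
  move=> s1; apply: le_trans (Boole_inequality P (fun k _ => mE tau s (inord k))) _.
  apply: (@le_trans _ _ (\sum_(k < d) q%:E)%E).
    by apply: lee_sum => k _; exact: coord_tail.
  by rewrite sumEFin sumr_const card_ord -[q *+ _]mulr_natl.
have B_sub : B `<=` U 1 `|` U (-1).
  move=> w /Bdev; rewrite ltNge => /negP Bw; apply: contrapT => notU; apply: Bw.
  have notE s j : s = 1 \/ s = -1 -> ~ E tau s j w.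
    move=> ss Esj; apply: notU.
    have UE : U s w.
      rewrite /U -(bigcup_mkord d (fun k => E tau s (inord k))).
      exists (j : nat); first exact: ltn_ord.
      by rewrite inord_val.
    by case: ss UE => ->; [left|right].
  apply: enorm_le_coord; first exact: ltW.
  move=> j; rewrite mxE [X in _ + X]mxE vhat_coord.
  have /negP := notE 1 j (or_introl erefl); rewrite -ltNge.
  have /negP := notE (-1) j (or_intror erefl); rewrite -ltNge.
  rewrite -!mulr_sumr !mul1r !mulN1r; move: (v ord0 j) (\sum_i _) => a S h1 h2.
  have nR : (0 : R) < n%:R by rewrite ltr0n.
  rewrite -(ler_pM2l nR) -[X in X * `|_|]gtr0_norm// -normrM mulrBr mulVKf ?gt_eqF//.
  by rewrite ler_norml; apply/andP; split; lra.
apply: le_trans (le_measure P _ _ B_sub) _; rewrite ?inE//.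
  exact: measurableU.
apply: le_trans (measureU2 _ (mU 1) (mU (-1))) _.
have -> : 2 * d%:R * q = d%:R * q + d%:R * q by ring.
by rewrite EFinD leeD ?PU ?normrN1 ?normr1.
Qed.

End concentration.

End estimator.

(** With [tau] as below, the exponent of the tail bound reaches [gamma * ln n] as
    soon as the radius exceeds its lower bound. *)
Lemma concentration_rate {R : realType} (gamma lnn n k W rad cx rho_min rho_max rr : R)
    (tau := 2 * cx * rho_min * rr / (rad * k)) :
  0 <= gamma -> 0 <= lnn -> 0 < n -> 0 < k -> 0 < W -> 0 < rad -> 0 < cx ->
  0 < rho_min -> 0 < rho_max -> 0 < rr ->
  3 * gamma * rho_max * k ^+ 2 * W * rad ^+ 2 / (cx ^+ 2 * rho_min ^+ 2) *
    (lnn / n) <= rr ->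
  gamma * lnn <= n * (tau ^+ 2 / (8 * (rho_max * W * rr))).
Proof.
move=> gamma0 lnn0 n0 k0 W0 rad0 cx0 rmin0 rmax0 rr0.
pose c := n * (cx ^+ 2 * rho_min ^+ 2) / (2 * rad ^+ 2 * k ^+ 2 * rho_max * W).
have c0 : 0 < c by rewrite /c divr_gt0 ?mulr_gt0 ?exprn_gt0.
have -> : n * (tau ^+ 2 / (8 * (rho_max * W * rr))) = rr * c.
  by rewrite /tau /c; field; rewrite !gt_eqF.
rewrite -(ler_pM2r c0).
have -> : 3 * gamma * rho_max * k ^+ 2 * W * rad ^+ 2 / (cx ^+ 2 * rho_min ^+ 2) *
    (lnn / n) * c = 3 / 2 * (gamma * lnn).
  by rewrite /c; field; rewrite !gt_eqF.
apply: le_trans.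
by have : 0 <= gamma * lnn by [rewrite mulr_ge0]; lra.
Qed.

(** The upper bound on the radius provides the condition of [sum_tail_bound] relating
    the deviation, the bound [r] and the second moment of the summands. *)
Lemma deviation_bound {R : realType} (k W rad cx cy rho_min rho_max r rr : R) :
  1 <= k -> 0 < W -> 0 < rad -> 0 < cx -> 0 < cy -> 0 < rho_min ->
  rho_min <= rho_max -> 0 < r -> 0 < rr -> cy <= 4 * W -> 2 * cx * r <= rad * cy ->
  2 * cx * rho_min * rr / (rad * k) * r <= 4 * (rho_max * W * rr).
Proof.
move=> k1 W0 rad0 cx0 cy0 rmin0 rminmax r0 rr0 cyW rcx.
have k0 : 0 < k by apply: lt_le_trans k1.
have -> : 2 * cx * rho_min * rr / (rad * k) * r =
    (2 * cx * r) * (rho_min * rr / (rad * k)) by field; rewrite !gt_eqF.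
apply: (@le_trans _ _ (rad * cy * (rho_min * rr / (rad * k)))).
  by rewrite ler_wpM2r// divr_ge0// ltW// mulr_gt0.
have -> : rad * cy * (rho_min * rr / (rad * k)) = cy * rho_min * rr / k.
  by field; rewrite !gt_eqF.
rewrite ler_pdivrMr//.
have h1 : cy * rho_min <= 4 * W * rho_max by rewrite ler_pM ?(ltW cy0) ?(ltW rmin0).
have h2 : cy * rho_min * rr <= 4 * W * rho_max * rr by rewrite ler_wpM2r// ltW.
apply: (le_trans h2); rewrite -!mulrA ler_wpM2l// mulrA [leLHS]mulrC.
rewrite (_ : rho_max * (W * (rr * k)) = rr * (rho_max * W) * k); last by ring.
rewrite [W * rho_max]mulrC ler_peMr// mulr_ge0 ?(ltW rr0)// mulr_ge0 ?(ltW W0)//; lra.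
Qed.

Theorem theorem2p6 (R : realType) (d : nat) (hd : (0 < d)%N)
  (Omega : set 'rV[R]_d) (hOmega : bounded_domain Omega)
  (rad : R) (hrad : 0 < rad)
  (hreach : (rad%:E <= reach Omega)%E)
  (hreachC : (rad%:E <= reach (~` Omega))%E)
  (rho : 'rV[R]_d -> R) (hrho : probability_density rho)
  (rho_min rho_max L : R) (hmin : 0 < rho_min)
  (hbounds : forall x, Omega x -> rho_min <= rho x <= rho_max)
  (hout : forall x, ~ Omega x -> rho x = 0)
  (hlip : forall x y, Omega x -> Omega y ->
     `|rho x - rho y| <= L * enorm (x - y))
  (dT : measure_display) (T : measurableType dT) (P : probability T R)
  (n : nat) (hn : (0 < n)%N)
  (X : 'I_n -> {RV P >-> 'rV[R]_d}) (hX : iid_sample rho X)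
  (gamma eps r : R) (hgamma : 2 < gamma) (heps : 0 < eps) (hr : 0 < r)
  (x0 : 'rV[R]_d) (hx0 : Omega x0)
  (hx0d : dist_to x0 (frontier Omega) <= 2 * eps)
  (nu0 : 'rV[R]_d) (hnu0 : normal_at Omega x0 nu0)
  (hepsr : eps / r <= (3 * Num.sqrt d%:R)^-1)
  (hr2 : r ^+ 2 <= rad * eps)
  (hrlow :
     (3 * gamma * rho_max * d%:R ^+ 2 * omega_ball R d * rad ^+ 2
        / (Cx d L rad rho_min ^+ 2 * rho_min ^+ 2)
      * (ln n%:R / n%:R)) `^ (d.+2%:R)^-1 <= r)
  (hrup : r <= rad * Cy R d / (2 * Cx d L rad rho_min)) :
  (P [set t | (13 * Cx d L rad rho_min / (rad * Cy R d) * r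
                <= enorm (nuhat r x0 (fun i => X i t) - nu0))%R]
   <= (2 * d%:R * n%:R `^ (- gamma))%:E)%E.
Proof.
case: d => [//|d'] in hd Omega hOmega hreach hreachC rho hrho hbounds hout hlip X hX
  x0 hx0 hx0d nu0 hnu0 hepsr hrlow hrup *.
set d := d'.+1.
have [_ oOmega _ _] := hOmega.
have [xs nxs inw] := hnu0; have nu1 := inw.1.
set cx := Cx _ _ _ _ in hrlow hrup *; set cy := Cy _ _ in hrup *.
set W := omega_ball R d in hrlow *.
have W0 : 0 < W := omega_ball_gt0.
have W'0 : 0 < omega_ball R d' := omega_ball_gt0.
pose delta := dist_to x0 (frontier Omega).
have [delta0 _] := frontier_nearest_normal oOmega hx0 nxs inw.
rewrite -/delta in delta0 hx0d.
have /andP[rho0min rho0max] := hbounds _ hx0.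
have rho00 : 0 < rho x0 by apply: lt_le_trans rho0min.
have rmax0 : 0 < rho_max by apply: lt_le_trans rho0max.
have rhomax x : rho x <= rho_max.
  by have [/hbounds/andP[]//|/hout ->] := pselect (Omega x); rewrite ltW.
(* L is nonnegative because the open set Omega has a second point. *)
have L0 : 0 <= L.
  have /nbhs_enormP[e e0 eO] := open_nbhs_nbhs (conj oOmega hx0).
  pose y := x0 + (e / 2) *: nu0.
  have yx : enorm (y - x0) = e / 2.
    by rewrite /y addrAC subrr add0r enormZ nu1 mulr1 gtr0_norm// divr_gt0.
  have Oy : Omega y by apply: eO; rewrite yx ltr_pdivrMr// mulr_natr mulr2n ltrDl.
  have := hlip _ _ Oy hx0; rewrite yx => h.
  by rewrite -(pmulr_lge0 L (_ : 0 < e / 2)) ?divr_gt0// (le_trans _ h).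
have cx2 : 2 * omega_ball R d' <= cx.
  by rewrite /cx /Cx lerDl !mulr_ge0// ?invr_ge0// ltW.
have cx0 : 0 < cx by apply: lt_le_trans cx2; rewrite mulr_gt0.
have cy0 : 0 < cy := Cy_gt0.
have rcx : 2 * cx * r <= rad * cy.
  by move: hrup; rewrite ler_pdivlMr ?mulr_gt0// mulrC.
have d1 : (1 : R) <= d%:R by rewrite ler1n.
have dpos : (0 : R) < d%:R by rewrite ltr0n.
have rrad : 4 * r <= rad.
  have cyW' : 4 * cy <= omega_ball R d'.
    rewrite /cy /Cy mulrA ler_pdivrMr ?mulr_gt0//.
    have d2 : (2 : R) <= d'.+2%:R by rewrite ler_nat.
    by rewrite [leRHS]mulrC ler_wpM2r ?(ltW W'0)//; clear -d2; lra.
  by clear -cyW' rcx cx2 W'0 hr hrad; nra.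
have delta_small : 9 * d%:R * delta ^+ 2 <= 4 * r ^+ 2.
  have sd0 : 0 < Num.sqrt d%:R :> R by rewrite sqrtr_gt0.
  have h1 : 3 * Num.sqrt d%:R * eps <= r.
    move: hepsr; rewrite ler_pdivrMr// mulrC ler_pdivlMr ?mulr_gt0//.
    by rewrite mulrC.
  have h2 : 3 * Num.sqrt d%:R * delta <= 2 * r.
    by clear -h1 hx0d sd0; nra.
  have h3 : 0 <= 3 * Num.sqrt d%:R * delta by rewrite !mulr_ge0// ltW.
  have : (3 * Num.sqrt d%:R * delta) ^+ 2 <= (2 * r) ^+ 2.
    by rewrite lerXn2r ?nnegrE// (le_trans h3).
  rewrite !exprMn sqr_sqrtr ?(ltW dpos)//; move: (d%:R : R) => k.
  by clear; lra.
have deltar : 0 < delta < r.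
  rewrite delta0/= -ltr_sqr ?nnegrE ?(ltW delta0) ?(ltW hr)//.
  have : 9 * delta ^+ 2 <= 9 * d%:R * delta ^+ 2.
    by rewrite ler_wpM2r ?sqr_ge0// ler_peMr.
  have : 0 < r ^+ 2 by rewrite exprn_gt0.
  by clear -delta_small; lra.
have [rr rrE] : exists rr, rr = r ^+ d'.+3 by exists (r ^+ d'.+3).
have rr0 : 0 < rr by rewrite rrE exprn_gt0.
(* The deviation allowed to each coordinate; the total deviation is then at most
   [d%:R * tau = 2 * rho_min * E0], which compares with the bias [rho x0 * E0]. *)
pose tau := 2 * cx * rho_min * rr / (rad * d%:R).
have tau0 : 0 < tau by rewrite divr_gt0 ?mulr_gt0.
have tauV : tau * r <= 4 * (rho_max * W * rr).
  apply: (@deviation_bound _ _ _ _ _ cy) => //; last exact: Cy_le_omega.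
  exact: le_trans rho0min rho0max.
have n0 : (0 : R) < n%:R by rewrite ltr0n.
have ln0 : 0 <= ln (n%:R : R) by rewrite ln_ge0// ler1n.
have gamma0 : 0 <= gamma by apply: ltW; apply: lt_trans hgamma.
have rate : gamma * ln n%:R <= n%:R * (tau ^+ 2 / (8 * (rho_max * W * rr))).
  apply: concentration_rate => //.
  set base := (X in X <= _).
  have base0 : 0 <= base.
    by rewrite /base !mulr_ge0 ?invr_ge0 ?mulr_ge0 ?sqr_ge0// ltW.
  have dn0 : (d.+2%:R : R) != 0 by rewrite pnatr_eq0.
  have -> : base = (base `^ (d.+2%:R)^-1) ^+ d.+2.
    by rewrite -powR_mulrn ?powR_ge0// -powRrM mulVf// powRr1.
  by rewrite rrE lerXn2r ?nnegrE ?powR_ge0 ?(ltW hr).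
set v : 'rV[R]_d := \row_j \int[lebesgue_rV d]_x (ball_coord x0 r j x * rho x).
pose h := Num.sqrt (r ^+ 2 - delta ^+ 2) ^+ d'.+2.
have hge : 7 / 15 * r ^+ d'.+2 <= h by exact: sqrt_pow_ge.
have rd2 : 0 < r ^+ d'.+2 by rewrite exprn_gt0.
pose m := rho x0 * (2 * cy * h).
have h0 : 0 < h by apply: lt_le_trans hge; rewrite mulr_gt0.
have m0 : 0 < m by rewrite /m mulr_gt0// mulr_gt0// mulr_gt0.
pose E0 := cx * rr / rad.
have E00 : 0 < E0 by rewrite divr_gt0 ?mulr_gt0.
have bias : enorm (v - m *: nu0) <= rho x0 * E0.
  have -> : m = rho x0 * (omega_ball R d' * (h / d'.+2%:R)).
    by rewrite /m /cy /Cy; field; rewrite gt_eqF// ltr0n.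
  rewrite /E0 rrE.
  apply: (@mean_estimate _ _ Omega rho rho_min L rad r x0 nu0) => //.
  by move=> x Ox; exact: hlip.
set bad := [set t | _]%R.
have mbad : measurable bad.
  rewrite (_ : bad = (fun t => enorm (nuhat r x0 (fun i => X i t) + - nu0)) @^-1`
      `[13 * cx / (rad * cy) * r, +oo[); last first.
    by apply/seteqP; split => t; rewrite /bad/= in_itv/= andbT.
  rewrite -[X in measurable X]setTI.
  have mX i : measurable_fun setT (X i) by exact: measurable_funPT.
  have := measurableT_comp measurable_enorm
    (measurableT_comp (measurable_addv (- nu0)) (measurable_nuhat r x0 mX)).
  by apply.
have dev w : bad w -> d%:R * tau < enorm (vhat r x0 (fun i => X i w) - v).
  rewrite /bad/= => badw; rewrite ltNge; apply/negP => small.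
  set a := vhat r x0 _ in small.
  have dtau : d%:R * tau = 2 * rho_min * E0.
    by rewrite /tau /E0; field; rewrite !gt_eqF.
  have err : enorm (a - m *: nu0) <= 3 * rho x0 * E0.
    apply: le_trans (enorm_triangle v _ _) _.
    have : 2 * rho_min * E0 <= 2 * rho x0 * E0 by rewrite ler_wpM2r ?(ltW E00)// ler_wpM2l.
    by move: small bias; rewrite dtau; clear; lra.
  (* The relative error is at most [45 / 7 * (cx * r / (rad * cy))], by [hge]. *)
  have := normalize_error nu1 m0 err; rewrite -/(nuhat r x0 _) => nuerr.
  have := le_trans badw nuerr; rewrite leNgt => /negP; apply.
  rewrite ltr_pdivrMr//.
  have -> : 13 * cx / (rad * cy) * r * m = rho x0 * (26 * (cx * r / rad) * h).
    by rewrite /m; field; rewrite !gt_eqF.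
  have -> : 2 * (3 * rho x0 * E0) = rho x0 * (6 * (cx * r / rad) * r ^+ d'.+2).
    by rewrite /E0 rrE [r ^+ d'.+3]exprS; field; rewrite gt_eqF.
  have c0 : 0 < cx * r / rad by rewrite divr_gt0 ?mulr_gt0.
  rewrite ltr_pM2l//; have := ler_wpM2l (ltW c0) hge.
  by have := mulr_gt0 c0 rd2; clear; lra.
rewrite rrE in tauV rate.
apply: le_trans (vhat_concentration hrho hX rhomax rmax0 hr hn tau0 tauV mbad dev) _.
rewrite lee_fin ler_wpM2l ?mulr_ge0// /powR gt_eqF// ler_expR mulNr lerN2.
exact: rate.
Qed.
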